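(* Let $X$ be either a complete connected Riemannian manifold with Riemannian volume measure $v$, or a lattice $l\mathbb{Z}^d\subset\mathbb{R}^d$ ($l>0$) with $v$ equal to $l^d$ times counting measure. Let $\Lambda\subseteq X$ be a measurable region with $|\Lambda|:=v(\Lambda)<\infty$. Let $u\colon X\times X\to\mathbb{R}$ be a symmetric conditionally positive definite kernel, i.e. for all $n\ge 2$, $x_1,\dots,x_n\in X$ and $c_1,\dots,c_n\in\mathbb{R}$ with $\sum_j c_j=0$ one has $\sum_{j,k=1}^n c_jc_k u(x_j,x_k)\ge 0$ (all functions are assumed measurable so that the integrals below are defined). Let $\beta>0$, $e>0$, $u_0\in\mathbb{R}$, and consider $s$ species $\alpha=1,\dots,s$ with activities $z_\alpha>0$ and charges $e_\alpha\in e\mathbb{Z}$; write $q_\alpha=e_\alpha/e\in\mathbb{Z}$. Assume charge symmetry: there is $c\in\mathbb{R}$ such that $\sum_{\alpha=1}^s e_\alpha^{2n+1}\mathrm{e}^{e_\alpha c}z_\alpha=0$ for all $n\in\{0,1,2,\dots\}$; fix such $c$ and set $z'_\alpha=\mathrm{e}^{e_\alpha c}z_\alpha$. Let $A_n=\{(\alpha_1,\dots,\alpha_n)\in\{1,\dots,s\}^n:\sum_j e_{\alpha_j}=0\}$ and $U_{\alpha_1,\dots,\alpha_n}(x_1,\dots,x_n)=\tfrac12\sum_{j,k=1}^n e_{\alpha_j}e_{\alpha_k}u(x_j,x_k)$. Define the neutral grand canonical partition function $$\Xi=\sum_{n=0}^\infty\frac1{n!}\sum_{(\alpha_1,\dots,\alpha_n)\in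 A_n}\int_{\Lambda^n}\mathrm{e}^{-\beta U_{\alpha_1,\dots,\alpha_n}(x_1,\dots,x_n)}\prod_{j=1}^n \mathrm{e}^{\frac12\beta e_{\alpha_j}^2u_0}z_{\alpha_j}\,v(\mathrm{d}x_j)$$ and the ideal-gas partition function $\Xi_0=\sum_{n=0}^\infty\frac1{n!}\sum_{(\alpha_1,\dots,\alpha_n)\in A_n}\prod_{j=1}^n z_{\alpha_j}|\Lambda|$ (the $n=0$ terms are $1$). For $q\in\mathbb{Z}$ let $$\hat\eta_q=\frac{\int_0^{2\pi}\exp\big[|\Lambda|\sum_{\alpha}z'_\alpha\cos(q_\alpha\theta)\big]\mathrm{e}^{\mathrm{i}q\theta}\,\mathrm{d}\theta}{\int_0^{2\pi}\exp\big[|\Lambda|\sum_{\alpha}z'_\alpha\cos(q_\alpha\theta)\big]\,\mathrm{d}\theta},\qquad \xi_0^{-2}=\beta\sum_{\alpha=1}^s e_\alpha^2z'_\alpha\hat\eta_{q_\alpha}.$$ Fix a basepoint $x_0\in X$ and let $\gamma$ be the centered Gaussian measure on the space of real functions on $X$ modulo constants whose covariance is $C$, i.e. under $\gamma$ the (well-defined) variables $\phi(x)-\phi(x_0)$ form a centered Gaussian process with $\mathbb{E}[(\phi(x)-\phi(x_0))(\phi(y)-\phi(x_0))]=u(x,y)-u(x,x_0)-u(x_0,y)+u(x_0,x_0)$. Set $$V_2(\phi)=\tfrac12\xi_0^{-2}\int_\Lambda(\phi(x)-\phi(x_0))^2\,v(\mathrm{d}x)-\tfrac12\xi_0^{-2}u_0|\Lambda|.$$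 Then $$\Xi\ \ge\ \Xi_0\int \mathrm{e}^{-V_2(\phi)}\,\gamma(\mathrm{d}\phi).$$
   Context: The Gaussian measure $\gamma$ lives on $\mathbb{R}^X/\Theta$, where $\mathbb{R}^X$ carries the product topology and $\Theta$ is the subspace of constant functions; its covariance $C$ is the positive semidefinite form on neutral finite charge distributions $\rho=\sum_j c_j\delta_{x_j}$ ($\sum_j c_j=0$) given by $C(\rho,\sigma)=\sum_{j,k}c_jd_ku(x_j,y_k)$ for $\sigma=\sum_k d_k\delta_{y_k}$, so that $\int \mathrm{e}^{\mathrm{i}\sum_j c_j\phi(x_j)}\gamma(\mathrm{d}\phi)=\exp[-\tfrac12C(\rho,\rho)]$. The quantity $\xi_0$ is the (volume-dependent) mean-field correlation length; $\hat\eta_q$ are the Fourier coefficients of the probability measure on $\mathbb{R}/2\pi\mathbb{Z}$ with density proportional to $\exp[|\Lambda|\sum_\alpha z'_\alpha\cos(q_\alpha\theta)]$. *)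

(* Defs.v *)
From HB Require Import structures.
From mathcomp Require Import all_boot all_order all_algebra.
From mathcomp Require Import all_classical all_reals all_analysis.
Set Implicit Arguments. Unset Strict Implicit. Unset Printing Implicit Defensive.
Import Order.TTheory GRing.Theory Num.Theory.
Import numFieldNormedType.Exports.
Local Open Scope classical_set_scope.
Local Open Scope ring_scope.

Section Defs.
Context (R : realType) (d : measure_display) (X : measurableType d).

Fixpoint iter_int (v : {measure set X -> \bar R}) (Lam : set X) (n : nat)
  (F : seq X -> \bar R) : \bar R :=
  match n with
  | 0 => F [::]
  | n'.+1 => (\int[v]_(x in Lam) iter_int v Lam n' (fun xs => F (x :: xs)))%E
  end.

Definition cond_pos_def (u : X -> X -> R) : Prop :=
  forall (n : nat) (x : 'I_n -> X) (c : 'I_n -> R), (2 <= n)%N ->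
    \sum_(j < n) c j = 0 ->
    0 <= \sum_(j < n) \sum_(k < n) c j * c k * u (x j) (x k).

(* A_n : neutral species assignments (charges e_alpha = e * q_alpha) *)
Definition neutral (s : nat) (q : 'I_s -> int) (n : nat) (a : {ffun 'I_n -> 'I_s}) : bool :=
  \sum_(j < n) q (a j) == 0.

Definition energy (s : nat) (ch : 'I_s -> R) (u : X -> X -> R) (x0 : X)
  (n : nat) (a : {ffun 'I_n -> 'I_s}) (xs : seq X) : R :=
  2^-1 * \sum_(j < n) \sum_(k < n)
      ch (a j) * ch (a k) * u (nth x0 xs j) (nth x0 xs k).

Definition Xi (v : {measure set X -> \bar R}) (Lam : set X) (s : nat)
  (q : 'I_s -> int) (e beta u0 : R) (z : 'I_s -> R) (u : X -> X -> R) (x0 : X)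
  : \bar R :=
  (\sum_(0 <= n <oo)
     ((n`!%:R)^-1)%:E *
     \sum_(a : {ffun 'I_n -> 'I_s} | neutral q a)
       iter_int v Lam n (fun xs =>
         (expR (- beta * energy (fun al => e * (q al)%:~R) u x0 a xs) *
          \prod_(j < n) (expR (2^-1 * beta * (e * (q (a j))%:~R) ^+ 2 * u0)
                          * z (a j)))%:E))%E.

Definition Xi0 (L : R) (s : nat) (q : 'I_s -> int) (z : 'I_s -> R) : \bar R :=
  (\sum_(0 <= n <oo)
     ((n`!%:R)^-1 *
      \sum_(a : {ffun 'I_n -> 'I_s} | neutral q a) \prod_(j < n) (z (a j) * L))%:E)%E.

Definition eta_weight (L : R) (s : nat) (q : 'I_s -> int) (z' : 'I_s -> R) (th : R) : R :=
  expR (L * \sum_(al < s) z' al * cos ((q al)%:~R * th)).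

(* Fourier coefficient hat eta_q (real part; the imaginary part vanishes since
   the weight is symmetric under theta |-> 2 pi - theta) *)
Definition eta_hat (L : R) (s : nat) (q : 'I_s -> int) (z' : 'I_s -> R) (k : int) : R :=
  Rintegral lebesgue_measure `[0, 2 * pi]
      (fun th => eta_weight L q z' th * cos (k%:~R * th)) /
  Rintegral lebesgue_measure `[0, 2 * pi] (eta_weight L q z').

Definition xi0_inv2 (L beta e : R) (s : nat) (q : 'I_s -> int) (z' : 'I_s -> R) : R :=
  beta * \sum_(al < s) (e * (q al)%:~R) ^+ 2 * z' al * eta_hat L q z' (q al).

Definition cov_x0 (u : X -> X -> R) (x0 : X) (x y : X) : R :=
  u x y - u x x0 - u x0 y + u x0 x0.

(* Y is a centered Gaussian process with covariance K, stated through its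
   characteristic function E[exp(i sum_j c_j Y(x_j))] = exp(-1/2 sum c_j c_k K(x_j,x_k)),
   split into real and imaginary parts *)
Definition centered_gaussian_process (dO : measure_display) (O : measurableType dO)
  (P : probability O R) (Y : O -> X -> R) (K : X -> X -> R) : Prop :=
  forall (n : nat) (x : 'I_n -> X) (c : 'I_n -> R),
    (\int[P]_w (cos (\sum_(j < n) c j * Y w (x j)))%:E
       = (expR (- 2^-1 * \sum_(j < n) \sum_(k < n) c j * c k * K (x j) (x k)))%:E)%E /\
    (\int[P]_w (sin (\sum_(j < n) c j * Y w (x j)))%:E = 0)%E.

(* V_2 evaluated on a field phi given through Y = phi(.) - phi(x0) *)
Definition V2 (v : {measure set X -> \bar R}) (Lam : set X) (xi2 u0 : R)
  (Y : X -> R) : \bar R :=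
  ((2^-1 * xi2)%:E * (\int[v]_(x in Lam) (Y x ^+ 2)%:E)
   - (2^-1 * xi2 * u0 * fine (v Lam))%:E)%E.

End Defs.

(* Main.v *)
Require Import Defs.
From HB Require Import structures.
From mathcomp Require Import all_boot all_order all_algebra.
From mathcomp Require Import all_classical all_reals all_analysis.
From mathcomp Require Import measurable_realfun complex ring lra.
Import Order.TTheory GRing.Theory Num.Theory.
Import numFieldNormedType.Exports.
Local Open Scope classical_set_scope.
Local Open Scope ring_scope.
Set Implicit Arguments.
Unset Strict Implicit.

(** Write [Lam] for the region and [nu] for the restriction of [v] to it. By
    the Gaussian identity and the projection onto neutral configurations by an
    angle [th], [Xi] is the average over the field and over [th] of [exp B],
    where [B = \sum_al w'_al \int_Lam cos (t_al Y + q_al th)]; similarly [Xi0]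
    is the average of the weight [W = exp ell] whose Fourier coefficients are
    [eta_hat]. Tilting by [exp (- V_2) W] and using [exp y >= 1 + y] with
    [y = B - ell + V_2], it is enough that [y] has nonnegative mean under the
    tilted measure. At every point [x] this reduces to
    [E cos (t Y(x)) >= exp (- t^2 E Y(x)^2 / 2)] for the tilted field. The
    latter is not computed: if [Y'] is an independent copy, the rotation
    [(Y, Y') -> ((Y + Y') / sqrt 2, (Y - Y') / sqrt 2)] preserves the law of
    the pair, and it preserves the tilt by the parallelogram law, so the tilted
    characteristic function satisfies [f(t)^2 = f(sqrt 2 t) f(0)]; iterating
    this from [f(t) >= f(0) - t^2 E Y(x)^2 / 2] gives the Gaussian bound. *)

(** The field is accessible only through the characteristic functions of its finite marginals, and
    [V2] may be infinite. Integrals against its law are therefore brought back to finite products of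
    cosines: exponentials of integrals of cosines are expanded in moments, and [exp (- V_2)] is
    obtained as a limit of such exponentials.

    The value of [xi0_inv2] is what allows the reduction to a single point [x]. Averaging [y] over
    the weighted angle turns [cos (q_al th)] into [eta_hat] and kills the sines. Put
    [t_al = sqrt beta * e_al], [c = t_al^2 u0 / 2] and [M = E Y(x)^2]; the Gaussian bound gives [exp
    c * E cos (t_al Y(x)) >= exp (c - t_al^2 M / 2) >= 1 + c - t_al^2 M / 2]. Summed with the
    weights [z'_al eta_hat(q_al)], which are nonnegative, the ones cancel against [ell], and the
    terms in [u0] and [M] cancel against [V_2] because [xi0_inv2] is the sum of the
    [z'_al eta_hat(q_al) t_al^2]. *)

Definition bounded_measurable {R : realType} {d} {T : measurableType d}
    (f : T -> R) :=
  measurable_fun setT f /\ exists M, forall x, `|f x| <= M.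

Lemma measurable_bigsum {R : realType} {d} {T : measurableType d}
    (I : Type) (s : seq I) (F : I -> T -> R) :
  (forall i, measurable_fun setT (F i)) ->
  measurable_fun setT (fun x => \sum_(i <- s) F i x).
Proof.
move=> mF; elim: s => [|i s ih].
  by under eq_fun do rewrite big_nil; exact: measurable_cst.
by under eq_fun do rewrite big_cons; exact: (measurable_funD (mF i) ih).
Qed.

Lemma measurable_section1 {d1 d2 d3} {T1 : measurableType d1}
    {T2 : measurableType d2} {T3 : measurableType d3} (A : T1 -> T2 -> T3) x :
  measurable_fun setT (fun p : T1 * T2 => A p.1 p.2) -> measurable_fun setT (A x).
Proof. by move=> mA; exact: (measurableT_comp mA (pair1_measurable x)). Qed.

Lemma measurable_section2 {d1 d2 d3} {T1 : measurableType d1}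
    {T2 : measurableType d2} {T3 : measurableType d3} (A : T1 -> T2 -> T3) y :
  measurable_fun setT (fun p : T1 * T2 => A p.1 p.2) ->
  measurable_fun setT (A ^~ y).
Proof. by move=> mA; exact: (measurableT_comp mA (pair2_measurable y)). Qed.

(** * Bounded measurable functions: closure, finite measures, Fubini *)

Section BoundedMeasurable.
Context {R : realType} {d : measure_display} {T : measurableType d}.
Implicit Types f g : T -> R.
Local Notation bm := bounded_measurable.

Lemma bm_bound f : bm f -> exists2 M, 0 <= M & forall x, `|f x| <= M.
Proof.
move=> [_ [M fM]]; exists `|M| => // x; exact: le_trans (fM x) (ler_norm M).
Qed.

Lemma bm_cst (c : R) : bm (fun _ : T => c).
Proof. by split=> //; exists `|c|. Qed.

Lemma bmD f g : bm f -> bm g -> bm (fun x => f x + g x).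
Proof.
move=> [mf [M fM]] [mg [N gN]]; split; first exact: measurable_funD.
by exists (M + N) => x; rewrite (le_trans (ler_normD _ _))// lerD.
Qed.

Lemma bmN f : bm f -> bm (fun x => - f x).
Proof.
by move=> [mf [M fM]]; split; [exact: measurableT_comp | exists M => x; rewrite normrN].
Qed.

Lemma bmB f g : bm f -> bm g -> bm (fun x => f x - g x).
Proof. by move=> bf bg; apply: bmD bf _; exact: bmN. Qed.

Lemma bmM f g : bm f -> bm g -> bm (fun x => f x * g x).
Proof.
move=> [mf [M fM]] [mg [N gN]]; split; first exact: measurable_funM.
by exists (M * N) => x; rewrite normrM ler_pM.
Qed.

Lemma bmZ (c : R) f : bm f -> bm (fun x => c * f x).
Proof. exact: bmM (bm_cst c). Qed.

Lemma bmX n f : bm f -> bm (fun x => f x ^+ n).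
Proof.
move=> bf; elim: n => [|n ih]; first exact: bm_cst.
by under eq_fun do rewrite exprS; exact: bmM.
Qed.

Lemma bm_sum (I : Type) (s : seq I) (Q : pred I) (F : I -> T -> R) :
  (forall i, bm (F i)) -> bm (fun x => \sum_(i <- s | Q i) F i x).
Proof.
move=> bF; elim: s => [|i s ih].
  by under eq_fun do rewrite big_nil; exact: bm_cst.
under eq_fun do rewrite big_cons; case: (Q i) => //; exact: bmD.
Qed.

Lemma bm_cos f : measurable_fun setT f -> bm (fun x => cos (f x)).
Proof.
move=> mf; split; last by exists 1 => x; rewrite ler_norml cos_geN1 cos_le1.
apply: measurableT_comp mf; apply: continuous_measurable_fun.
exact: continuous_cos.
Qed.

Lemma bm_sin f : measurable_fun setT f -> bm (fun x => sin (f x)).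
Proof.
move=> mf; split; last by exists 1 => x; rewrite ler_norml sin_geN1 sin_le1.
apply: measurableT_comp mf; apply: continuous_measurable_fun.
exact: continuous_sin.
Qed.

Lemma bm_exp f : bm f -> bm (fun x => expR (f x)).
Proof.
move=> [mf [M fM]]; split; first exact: measurableT_comp.
exists (expR M) => x; rewrite ger0_norm ?expR_ge0// ler_expR.
exact: le_trans (ler_norm _) (fM x).
Qed.

Lemma bm_comp {d'} {T' : measurableType d'} (h : T' -> T) f :
  measurable_fun setT h -> bm f -> bm (fun x => f (h x)).
Proof.
by move=> mh [mf [M fM]]; split; [exact: measurableT_comp | exists M].
Qed.

End BoundedMeasurable.

Section BoundedIntegral.
Context {R : realType} {d : measure_display} {T : measurableType d}.
Variable mu : {finite_measure set T -> \bar R}.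
Implicit Types f g : T -> R.
Local Notation bm := bounded_measurable.

Lemma bm_integrable f : bm f -> mu.-integrable setT (EFin \o f).
Proof.
move=> bf; have [M M0 fM] := bm_bound bf; have [mf _] := bf.
apply: measurable_bounded_integrable => //; first exact: fin_num_fun_lty.
by exists M; split; rewrite ?num_real// => x Mx y _; exact: le_trans (fM y) (ltW Mx).
Qed.

Lemma bm_RintegralE f : bm f -> (\int[mu]_x (f x)%:E)%E = (\int[mu]_x f x)%:E.
Proof.
move=> /bm_integrable bf; rewrite /Rintegral fineK//.
exact: integrable_fin_num.
Qed.

Lemma bm_RintegralD f g : bm f -> bm g ->
  \int[mu]_x (f x + g x) = \int[mu]_x f x + \int[mu]_x g x.
Proof. by move=> bf bg; apply: RintegralD => //; exact: bm_integrable. Qed.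

Lemma bm_RintegralB f g : bm f -> bm g ->
  \int[mu]_x (f x - g x) = \int[mu]_x f x - \int[mu]_x g x.
Proof. by move=> bf bg; apply: RintegralB => //; exact: bm_integrable. Qed.

Lemma bm_RintegralZl (c : R) f : bm f ->
  \int[mu]_x (c * f x) = c * \int[mu]_x f x.
Proof. by move=> bf; apply: RintegralZl => //; exact: bm_integrable. Qed.

Lemma bm_RintegralZr (c : R) f : bm f ->
  \int[mu]_x (f x * c) = (\int[mu]_x f x) * c.
Proof. by move=> bf; apply: RintegralZr => //; exact: bm_integrable. Qed.

Lemma bm_le_Rintegral f g : bm f -> bm g -> (forall x, f x <= g x) ->
  \int[mu]_x f x <= \int[mu]_x g x.
Proof.
by move=> bf bg fg; apply: le_Rintegral => //; exact: bm_integrable.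
Qed.

Lemma bm_Rintegral_bound f M : bm f -> (forall x, `|f x| <= M) ->
  `|\int[mu]_x f x| <= M * fine (mu setT).
Proof.
move=> bf fM; rewrite ler_norml -mulNr -!Rintegral_cst//.
apply/andP; split; apply: bm_le_Rintegral => //; try exact: bm_cst.
  by move=> x; have := fM x; rewrite ler_norml => /andP[].
by move=> x; have := fM x; rewrite ler_norml => /andP[].
Qed.

Lemma bm_Rintegral_sum (I : Type) (s : seq I) (Q : pred I) (F : I -> T -> R) :
  (forall i, bm (F i)) ->
  \int[mu]_x (\sum_(i <- s | Q i) F i x) = \sum_(i <- s | Q i) \int[mu]_x F i x.
Proof.
move=> bF; elim: s => [|i s ih].
  rewrite big_nil; under eq_Rintegral do rewrite big_nil.
  by rewrite Rintegral_cst// mul0r.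
rewrite big_cons; under eq_Rintegral do rewrite big_cons.
case: (Q i) => //; rewrite bm_RintegralD ?ih//; exact: bm_sum.
Qed.

Lemma bm_Rintegral_cvg (f_ : nat -> T -> R) f (M : R) :
  (forall n, measurable_fun setT (f_ n)) -> (forall n x, `|f_ n x| <= M) ->
  (forall x, f_ n x @[n --> \oo] --> f x) ->
  \int[mu]_x f_ n x @[n --> \oo] --> \int[mu]_x f x.
Proof.
move=> mf_ f_M f_f.
have bf_ n : bm (f_ n) by split=> //; exists M.
have mf : measurable_fun setT f by apply: (measurable_fun_cvg mf_) => x _; exact: f_f.
have bf : bm f.
  split=> //; exists M => x; rewrite ler_norml; apply/andP; split.
    apply: (cvgr_to_ge (f_f x)); near=> n; move: (f_M n x).
    by rewrite ler_norml => /andP[].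
  apply: (cvgr_to_le (f_f x)); near=> n; move: (f_M n x).
  by rewrite ler_norml => /andP[].
suff : (\int[mu]_x (f_ n x)%:E)%E @[n --> \oo] --> (\int[mu]_x (f x)%:E)%E.
  rewrite bm_RintegralE//; under eq_fun do rewrite bm_RintegralE//.
  by move/fine_cvgP => -[].
apply: (@dominated_cvg _ _ _ mu setT _ (fun n x => (f_ n x)%:E)
   (fun x => (f x)%:E) (fun=> M%:E)) => //.
- by move=> n; exact/measurable_EFinP.
- by move=> x _; apply: cvg_EFin; [exact: nearW | exact: f_f].
- by apply: (@bm_integrable (fun=> M)); exact: bm_cst.
- by move=> n x _; rewrite lee_fin.
Unshelve. all: by end_near. Qed.

End BoundedIntegral.

Section BoundedFubini.
Context {R : realType} {d1 d2 : measure_display}.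
Context {T1 : measurableType d1} {T2 : measurableType d2}.
Variable m1 : {finite_measure set T1 -> \bar R}.
Variable m2 : {finite_measure set T2 -> \bar R}.
Local Notation bm := bounded_measurable.

Lemma bm_prod_integrable (f : T1 * T2 -> R) : bm f ->
  (m1 \x m2)%E.-integrable setT (EFin \o f).
Proof.
move=> bf; have [M M0 fM] := bm_bound bf; have [mf _] := bf.
apply: measurable_bounded_integrable => //.
  rewrite -setXTT [X in (X < _)%E]product_measure1E//.
  by apply: lte_mul_pinfty; rewrite ?measure_ge0// ?fin_num_measure// fin_num_fun_lty.
by exists M; split; rewrite ?num_real// => x Mx y _; exact: le_trans (fM y) (ltW Mx).
Qed.

Lemma bm_pair1 (f : T1 * T2 -> R) x : bm f -> bm (fun y => f (x, y)).
Proof. by apply: bm_comp; exact: pair1_measurable. Qed.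

Lemma bm_pair2 (f : T1 * T2 -> R) y : bm f -> bm (fun x => f (x, y)).
Proof. by apply: bm_comp; exact: pair2_measurable. Qed.

(** Measurability in [x] is read off Fubini for the integrable function [f], which is why a finite
    measure [m1] on the first factor is fixed although the integral is over [m2]. *)
Lemma bm_Rintegral2 (f : T1 * T2 -> R) : bm f ->
  bm (fun x => \int[m2]_y f (x, y)).
Proof.
move=> bf; have [M M0 fM] := bm_bound bf; split.
  have := measurable_fubini_F (bm_prod_integrable bf).
  rewrite /fubini_F /=; under eq_fun do (rewrite bm_RintegralE; last exact: bm_pair1).
  by move/measurable_EFinP.
exists (M * fine (m2 setT)) => x.
by apply: bm_Rintegral_bound => //; exact: bm_pair1.
Qed.

Lemma bm_Rintegral1 (f : T1 * T2 -> R) : bm f ->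
  bm (fun y => \int[m1]_x f (x, y)).
Proof.
move=> bf; have [M M0 fM] := bm_bound bf; split.
  have := measurable_fubini_G (bm_prod_integrable bf).
  rewrite /fubini_G /=; under eq_fun do (rewrite bm_RintegralE; last exact: bm_pair2).
  by move/measurable_EFinP.
exists (M * fine (m1 setT)) => y.
by apply: bm_Rintegral_bound => //; exact: bm_pair2.
Qed.

Lemma bm_Fubini (f : T1 * T2 -> R) : bm f ->
  \int[m1]_x \int[m2]_y f (x, y) = \int[m2]_y \int[m1]_x f (x, y).
Proof.
move=> bf; apply: EFin_inj.
rewrite -!bm_RintegralE; [|exact: bm_Rintegral1|exact: bm_Rintegral2].
under eq_integral do (rewrite -bm_RintegralE; last exact: bm_pair1).
under [RHS]eq_integral do (rewrite -bm_RintegralE; last exact: bm_pair2).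
exact: (Fubini (bm_prod_integrable bf)).
Qed.

Lemma bm_Rintegral_prod (f : T1 * T2 -> R) : bm f ->
  fine (\int[m1 \x m2]_z (f z)%:E)%E = \int[m1]_x \int[m2]_y f (x, y).
Proof.
move=> bf; rewrite -(integral12_prod_meas1 (bm_prod_integrable bf)).
rewrite /fubini_F/=; under eq_integral do (rewrite bm_RintegralE; last exact: bm_pair1).
by rewrite bm_RintegralE//; exact: bm_Rintegral2.
Qed.

End BoundedFubini.

(** * Expansion of the exponential under an integral *)

Lemma le_series_exp_coeff {R : realType} (x y : R) n : `|x| <= y ->
  `|\sum_(0 <= k < n) k`!%:R^-1 * x ^+ k| <= expR y.
Proof.
move=> xy; have y0 : 0 <= y by exact: le_trans xy.
apply: (@le_trans _ _ (series (exp_coeff y) n)); last first.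
  apply: nondecreasing_cvgn_le; last exact: is_cvg_series_exp_coeff.
  by apply: nondecreasing_series => k _ _; exact: exp_coeff_ge0.
rewrite /series/= exp_coeffE; apply: le_trans (ler_norm_sum _ _ _) _.
apply: ler_sum => k _; rewrite normrM normrX ger0_norm ?invr_ge0//.
by rewrite ler_wpM2l ?invr_ge0// lerXn2r// nnegrE.
Qed.

(** Dominated convergence, the partial sums being bounded by the exponential of the bound of [S]. It
    carries identities and signs from moments, where only products of cosines occur, to
    exponentials. *)
Lemma exp_moments_cvg {R : realType} {d} {T : measurableType d}
    (mu : {finite_measure set T -> \bar R}) (H S : T -> R) :
  bounded_measurable H -> bounded_measurable S ->
  \sum_(0 <= k < n) k`!%:R^-1 * (\int[mu]_w (H w * S w ^+ k)) @[n --> \oo]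
    --> \int[mu]_w (H w * expR (S w)).
Proof.
move=> bH bS; have [M M0 HM] := bm_bound bH; have [K K0 SK] := bm_bound bS.
have bS' k : bounded_measurable (fun w => k`!%:R^-1 * S w ^+ k).
  by apply: bmZ; exact: bmX.
have -> : (fun n : nat => \sum_(0 <= k < n) k`!%:R^-1 *
      (\int[mu]_w (H w * S w ^+ k))) =
    (fun n => \int[mu]_w (H w * \sum_(0 <= k < n) k`!%:R^-1 * S w ^+ k)).
  apply/funext => n; under [RHS]eq_Rintegral do rewrite mulr_sumr.
  rewrite bm_Rintegral_sum; last by move=> k; exact: bmM.
  apply: eq_bigr => k _; under [RHS]eq_Rintegral do rewrite mulrCA.
  by rewrite bm_RintegralZl//; apply: bmM => //; exact: bmX.
apply: (@bm_Rintegral_cvg _ _ _ mu _ _ (M * expR K)).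
- by move=> n; case: (bmM bH (bm_sum (index_iota 0 n) xpredT bS')).
- by move=> n x; rewrite normrM ler_pM// le_series_exp_coeff.
- move=> x; apply: cvgM; first exact: cvg_cst.
  have := is_cvg_series_exp_coeff (S x).
  by rewrite /expR /series/= exp_coeffE.
Qed.

(** * Complex-valued integrals *)

Local Notation Re := complex.Re.
Local Notation Im := complex.Im.

Definition cexpi {R : realType} (t : R) : R[i] := (cos t +i* sin t)%C.

Lemma cexpiD {R : realType} : {morph @cexpi R : x y / x + y >-> x * y}.
Proof. by move=> x y; rewrite /cexpi cosD sinD; congr (_ +i* _)%C; rewrite addrC. Qed.

Lemma cexpi0 {R : realType} : @cexpi R 0 = 1.
Proof. by rewrite /cexpi cos0 sin0. Qed.

Section ComplexBounded.
Context {R : realType} {d : measure_display} {T : measurableType d}.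
Implicit Types f g : T -> R[i].

Definition cbounded_measurable f :=
  bounded_measurable (fun x => Re (f x)) /\
  bounded_measurable (fun x => Im (f x)).

Definition cintegral (mu : {finite_measure set T -> \bar R}) f : R[i] :=
  ((\int[mu]_x Re (f x)) +i* (\int[mu]_x Im (f x)))%C.

Lemma cbmM f g : cbounded_measurable f -> cbounded_measurable g ->
  cbounded_measurable (fun x => f x * g x).
Proof.
move=> [f1 f2] [g1 g2]; split.
  rewrite (_ : (fun x => _) = fun x => Re (f x) * Re (g x) - Im (f x) * Im (g x)).
    by apply: bmB; exact: bmM.
  by apply/funext => x; case: (f x) => a b; case: (g x).
rewrite (_ : (fun x => _) = fun x => Re (f x) * Im (g x) + Im (f x) * Re (g x)).
  by apply: bmD; exact: bmM.
by apply/funext => x; case: (f x) => a b; case: (g x).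
Qed.

Lemma cbm_prod (I : Type) (s : seq I) (F : I -> T -> R[i]) :
  (forall i, cbounded_measurable (F i)) ->
  cbounded_measurable (fun x => \prod_(i <- s) F i x).
Proof.
move=> bF; elim: s => [|i s ih].
  by under eq_fun do rewrite big_nil; split; exact: bm_cst.
by under eq_fun do rewrite big_cons; exact: cbmM.
Qed.

Lemma cintegral_ReM (mu : {finite_measure set T -> \bar R}) (a : R[i]) f :
  cbounded_measurable f -> \int[mu]_x Re (a * f x) = Re (a * cintegral mu f).
Proof.
move=> [f1 f2]; case: a => a b /=.
rewrite -!bm_RintegralZl// -bm_RintegralB; try exact: bmZ.
by apply: eq_Rintegral => x _; case: (f x).
Qed.

Lemma cintegralZ (mu : {finite_measure set T -> \bar R}) (a : R[i]) f :
  cbounded_measurable f -> cintegral mu (fun x => a * f x) = a * cintegral mu f.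
Proof.
move=> bf; rewrite {1}/cintegral cintegral_ReM//.
suff -> : \int[mu]_x Im (a * f x) = Im (a * cintegral mu f).
  by case: (a * _).
case: bf => f1 f2; case: a => a b /=.
rewrite -!bm_RintegralZl// -bm_RintegralD; try exact: bmZ.
by apply: eq_Rintegral => x _; case: (f x).
Qed.

End ComplexBounded.

Lemma cbm_cexpi {R : realType} {d} {T : measurableType d} (f : T -> R) :
  measurable_fun setT f -> cbounded_measurable (fun x => cexpi (f x)).
Proof. by move=> mf; split; [exact: bm_cos | exact: bm_sin]. Qed.

(** * Iterated integrals over the region *)

Section FiniteRegion.
Context {R : realType} {d : measure_display} {X : measurableType d}.
Variables (v : {measure set X -> \bar R}) (Lam : set X).
Hypotheses (mLam : measurable Lam) (finLam : (v Lam < +oo)%E).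

Definition vrestr : {finite_measure set X -> \bar R} := mfrestr mLam finLam.

Lemma vrestr_setT : vrestr setT = v Lam.
Proof. by rewrite /vrestr/= /mfrestr /mrestr setTI. Qed.

Let nuC : vrestr (~` Lam) = 0%E.
Proof. by rewrite /vrestr/= /mfrestr /mrestr setICl measure0. Qed.

Let eq_vrestr (f : X -> \bar R) :
  (\int[v]_(x in Lam) f x = \int[vrestr]_(x in Lam) f x)%E.
Proof.
apply: eq_measure_integral => A mA AL.
by rewrite /vrestr/= /mfrestr /mrestr setIidl.
Qed.

Lemma ge0_vrestrE (f : X -> \bar R) : measurable_fun setT f ->
  (forall x, 0 <= f x)%E ->
  (\int[v]_(x in Lam) f x = \int[vrestr]_x f x)%E.
Proof.
move=> mf f0; rewrite eq_vrestr (@ge0_negligible_integral _ _ _ vrestr setT (~` Lam))//.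
- by rewrite setTD setCK.
- exact: measurableC.
Qed.

Lemma bm_vrestrE (f : X -> R) : bounded_measurable f ->
  (\int[v]_(x in Lam) (f x)%:E)%E = (\int[vrestr]_x f x)%:E.
Proof.
move=> bf; rewrite eq_vrestr -bm_RintegralE//.
rewrite [RHS](@negligible_integral _ _ _ vrestr setT (~` Lam))//.
- by rewrite setTD setCK.
- exact: measurableC.
- exact: bm_integrable.
Qed.

Context {dO : measure_display} {O : measurableType dO}.
Variable mu : {finite_measure set O -> \bar R}.

(** Induction on the number of points: with the first point fixed, [g 0] is absorbed into [Z], the
    induction hypothesis integrates the other points, and Fubini exchanges [w] with the first one.
    Hence [Z] is kept general. *)
Lemma iter_int_cintegral (x0 : X) n (g : nat -> O * X -> R[i]) (Z : O -> R[i]) :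
  (forall j, cbounded_measurable (g j)) -> cbounded_measurable Z ->
  iter_int v Lam n (fun xs =>
     (\int[mu]_w Re (Z w * \prod_(j < n) g j (w, nth x0 xs j)))%:E) =
  (\int[mu]_w Re (Z w * \prod_(j < n) cintegral vrestr (fun x => g j (w, x))))%:E.
Proof.
elim: n g Z => [|n ih] g Z bg bZ /=.
  by congr EFin; apply: eq_Rintegral => w _; rewrite !big_ord0.
have bg1 j w : cbounded_measurable (fun x => g j (w, x)).
  by have [b1 b2] := bg j; split; [exact: (bm_pair1 w b1) | exact: (bm_pair1 w b2)].
have bg2 j x : cbounded_measurable (fun w => g j (w, x)).
  by have [b1 b2] := bg j; split; [exact: (bm_pair2 x b1) | exact: (bm_pair2 x b2)].
have bgc j : cbounded_measurable (fun w => cintegral vrestr (fun x => g j (w, x))).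
  have [b1 b2] := bg j.
  by split; [exact: (bm_Rintegral2 mu vrestr b1) | exact: (bm_Rintegral2 mu vrestr b2)].
pose A w := \prod_(j < n) cintegral vrestr (fun x => g j.+1 (w, x)).
have bA : cbounded_measurable A by apply: cbm_prod => j; exact: bgc.
pose h (p : O * X) := Re (Z p.1 * A p.1 * g 0%N p).
have bh : bounded_measurable h.
  apply: proj1; apply: cbmM (bg 0%N).
  have [b1 b2] := cbmM bZ bA.
  by split; [move: b1 | move: b2]; apply: bm_comp; exact: measurable_fst.
transitivity (\int[v]_(x in Lam) (\int[mu]_w h (w, x))%:E)%E.
  apply: eq_integral => x _.
  transitivity (iter_int v Lam n (fun xs => (\int[mu]_w Re (Z w * g 0%N (w, x) *
      \prod_(j < n) g j.+1 (w, nth x0 xs j)))%:E)).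
    congr iter_int; apply/funext => xs; congr EFin; apply: eq_Rintegral => w _.
    by rewrite big_ord_recl mulrA.
  rewrite (ih (fun j => g j.+1))//; last exact: cbmM.
  by congr EFin; apply: eq_Rintegral => w _; rewrite /h/= -/(A w) mulrAC.
rewrite bm_vrestrE; last exact: (bm_Rintegral1 mu vrestr bh).
rewrite -bm_Fubini//; congr EFin; apply: eq_Rintegral => w _.
rewrite /h/= cintegral_ReM//; congr Re.
by rewrite big_ord_recl/= -mulrA [A w * _]mulrC.
Qed.

Lemma iter_int_Rintegral (x0 : X) n (G : O * X -> R) (H : O -> R) :
  bounded_measurable G -> bounded_measurable H ->
  iter_int v Lam n (fun xs =>
     (\int[mu]_w (H w * \prod_(j < n) G (w, nth x0 xs j)))%:E) =
  (\int[mu]_w (H w * (\int[vrestr]_x G (w, x)) ^+ n))%:E.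
Proof.
move=> bG bH.
have ReC (a b : R) : Re (a%:C * b%:C)%C = a * b by rewrite /= mul0r subr0.
have := @iter_int_cintegral x0 n (fun _ p => (G p)%:C)%C (fun w => (H w)%:C)%C.
have bC d' (T : measurableType d') (f : T -> R) : bounded_measurable f ->
    cbounded_measurable (fun x => (f x)%:C)%C.
  by move=> bf; split=> //=; exact: bm_cst.
move=> /(_ (fun=> bC _ _ _ bG) (bC _ _ _ bH)) E.
transitivity (iter_int v Lam n (fun xs => (\int[mu]_w
    Re ((H w)%:C * \prod_(j < n) (G (w, nth x0 xs j))%:C)%C)%:E)).
  congr iter_int; apply/funext => xs; congr EFin; apply: eq_Rintegral => w _.
  by rewrite -(rmorph_prod (real_complex R)) ReC.
rewrite E; congr EFin; apply: eq_Rintegral => w _.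
rewrite prodr_const card_ord /cintegral/=.
rewrite (_ : \int[vrestr]_x 0 = 0); last by rewrite Rintegral_cst// mul0r.
by rewrite -(rmorphXn (real_complex R)) ReC.
Qed.

End FiniteRegion.

(** * Odd functions of the charges *)

Lemma poly_interpolation (F : fieldType) (s : seq F) (f : F -> F) :
  exists p : {poly F}, forall x, x \in s -> p.[x] = f x.
Proof.
elim: s => [|x s [p pf]]; first by exists 0.
have [xs|xs] := boolP (x \in s).
  by exists p => y; rewrite inE => /predU1P[->|]; exact: pf.
pose r := \prod_(y <- s) ('X - y%:P).
have rx : r.[x] != 0 by rewrite -rootE root_prod_XsubC.
exists (p + ((f x - p.[x]) / r.[x]) *: r) => y.
rewrite hornerD hornerZ inE => /predU1P[->|ys]; first by rewrite divfK// subrKC.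
have /eqP -> : root r y by rewrite root_prod_XsubC.
by rewrite mulr0 addr0 pf.
Qed.

(* An odd function agrees on the finitely many charges with an odd polynomial. *)
Lemma odd_moments_odd_fun {R : realType} (s : nat) (ch m : 'I_s -> R) (h : R -> R) :
  (forall n : nat, \sum_(al < s) m al * ch al ^+ (2 * n).+1 = 0) ->
  (forall x, h (- x) = - h x) -> \sum_(al < s) m al * h (ch al) = 0.
Proof.
move=> chm hN.
(* The odd polynomial is [x * p (x^2)]; interpolating at the squared charges forces oddness. At a
   zero charge both sides vanish because [h] is odd. *)
have [p pE] := poly_interpolation [seq ch al ^+ 2 | al : 'I_s]
  (fun y => h (Num.sqrt y) / Num.sqrt y).
have hE al : h (ch al) = ch al * p.[ch al ^+ 2].
  rewrite pE; last by apply/mapP; exists al => //; rewrite mem_enum.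
  rewrite sqrtr_sqr; have [->|c0] := eqVneq (ch al) 0.
    by have := hN 0; rewrite oppr0 mul0r; lra.
  have [c1|c1] := ger0P (ch al); first by rewrite mulrC divfK.
  by rewrite hN invrN mulrNN mulrC divfK.
under eq_bigr do rewrite hE horner_coef !mulr_sumr.
rewrite exchange_big big1// => i _ /=.
transitivity (p`_i * \sum_(al < s) m al * ch al ^+ (2 * i).+1); last first.
  by rewrite chm mulr0.
rewrite mulr_sumr; apply: eq_bigr => al _; rewrite -exprM (exprS _ (2 * i)); ring.
Qed.

(** * Fourier analysis on the circle *)

Lemma sin_int2pi {R : realType} (k : int) : sin (k%:~R * (2 * pi)) = 0 :> R.
Proof.
suff H (n : nat) : sin (n%:R * (2 * pi)) = 0 :> R.
  by case: k => n; rewrite ?NegzE ?mulrNz ?mulNr ?sinN -?pmulrn H ?oppr0.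
elim: n => [|n ih]; first by rewrite mul0r sin0.
by rewrite -natr1 mulrDl mul1r [X in _ + X]mulr_natl sinD2pi.
Qed.

Lemma cos_int2pi {R : realType} (k : int) : cos (k%:~R * (2 * pi)) = 1 :> R.
Proof.
suff H (n : nat) : cos (n%:R * (2 * pi)) = 1 :> R.
  by case: k => n; rewrite ?NegzE ?mulrNz ?mulNr ?cosN -?pmulrn H.
elim: n => [|n ih]; first by rewrite mul0r cos0.
by rewrite -natr1 mulrDl mul1r [X in _ + X]mulr_natl cosD2pi.
Qed.

Section Circle.
Context {R : realType}.

Let lebesgue_circle_lty :
  ((@lebesgue_measure R) `[0%R, (2 * pi)%R]%classic < +oo)%E.
Proof. by rewrite /= lebesgue_measure_itv/=; case: ifP => _; rewrite ltry. Qed.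

(** The angle lives on the whole line with restricted Lebesgue measure, so that the bounded calculus
    applies. The measure is not normalised, hence the factors [(2 * pi)^-1] below. *)
Definition circle : {finite_measure set (measurableTypeR R) -> \bar R} :=
  @vrestr R _ (measurableTypeR R) lebesgue_measure _
    (measurable_itv `[0%R, 2 * pi]) lebesgue_circle_lty.

Lemma circleE (f : measurableTypeR R -> R) : bounded_measurable f ->
  \int[lebesgue_measure]_(x in `[0, 2 * pi]) f x = \int[circle]_x f x.
Proof.
by move=> bf; rewrite {1}/Rintegral 
  (@bm_vrestrE R _ (measurableTypeR R) lebesgue_measure _
     (measurable_itv _) lebesgue_circle_lty).
Qed.

Lemma circle_setT : fine (circle setT) = 2 * pi.
Proof.
rewrite /circle vrestr_setT/= lebesgue_measure_itv/= lte_fin.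
by rewrite mulr_gt0 ?pi_gt0//= oppr0 addr0.
Qed.

Lemma circle_FTC (F f : R -> R) : @bounded_measurable R _ (measurableTypeR R) f -> continuous f ->
  (forall x : R, is_derive x 1 F (f x)) ->
  \int[circle]_x f x = F (2 * pi) - F 0.
Proof.
move=> bf cf dF; rewrite -circleE// /Rintegral (@continuous_FTC2 _ _ F)//.
- by rewrite mulr_gt0 ?pi_gt0.
- exact: continuous_subspaceT.
- have cF : continuous F.
    by move=> x; apply/differentiable_continuous/derivable1_diffP; exact: ex_derive.
  split=> [x _| |]; first exact: ex_derive.
    by apply: cvg_at_right_filter; exact: cF.
  by apply: cvg_at_left_filter; exact: cF.
- by move=> x _; rewrite derive1E; apply: derive_val.
Qed.

Lemma circle_cos (k : int) :
  \int[circle]_x cos (k%:~R * x) = if k == 0 then 2 * pi else 0.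
Proof.
have [->|k0] := eqVneq k 0.
  under eq_Rintegral do rewrite mul0r cos0.
  by rewrite Rintegral_cst// mul1r circle_setT.
have kR : k%:~R != 0 :> R by rewrite intr_eq0.
pose F (x : R) := (k%:~R)^-1 * sin (k%:~R * x).
have -> : \int[circle]_x cos (k%:~R * x) = F (2 * pi) - F 0; last first.
  by rewrite /F sin_int2pi !mulr0 sin0 mulr0 subr0.
apply: circle_FTC.
- exact: bm_cos.
- move=> x; apply: continuous_comp; last exact: continuous_cos.
  by apply: cvgM; [exact: cvg_cst | exact: cvg_id].
- move=> x; apply: is_derive_eq.
  by rewrite /GRing.scale/=; field.
Qed.

Lemma circle_sin (k : int) : \int[circle]_x sin (k%:~R * x) = 0.
Proof.
have [->|k0] := eqVneq k 0.
  under eq_Rintegral do rewrite mul0r sin0.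
  by rewrite Rintegral_cst// mul0r.
have kR : k%:~R != 0 :> R by rewrite intr_eq0.
pose F (x : R) := - (k%:~R)^-1 * cos (k%:~R * x).
have -> : \int[circle]_x sin (k%:~R * x) = F (2 * pi) - F 0; last first.
  by rewrite /F cos_int2pi mulr0 cos0 subrr.
apply: circle_FTC.
- exact: bm_sin.
- move=> x; apply: continuous_comp; last exact: continuous_sin.
  by apply: cvgM; [exact: cvg_cst | exact: cvg_id].
- move=> x; apply: is_derive_eq.
  by rewrite /GRing.scale/=; field.
Qed.

Lemma cintegral_circle (k : int) :
  cintegral circle (fun x => cexpi (k%:~R * x)) =
  if k == 0 then (2 * pi)%:C%C else 0.
Proof. by rewrite /cintegral circle_cos circle_sin; case: eqP. Qed.

(** Expanding the power over all assignments, each term carries the phase [N * th] with [N] its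
    total charge number, and integration over the circle keeps [N = 0] only. *)
Lemma neutral_projection (s n : nat) (q : 'I_s -> int) (T : 'I_s -> R[i]) :
  \int[circle]_th Re ((\sum_(al < s) T al * cexpi ((q al)%:~R * th)) ^+ n) =
  2 * pi * \sum_(a : {ffun 'I_n -> 'I_s} | neutral q a) Re (\prod_(j < n) T (a j)).
Proof.
pose N (a : {ffun 'I_n -> 'I_s}) : int := \sum_(j < n) q (a j).
have bc (k : int) : cbounded_measurable (fun th : measurableTypeR R => cexpi (k%:~R * th)).
  exact: cbm_cexpi.
transitivity (\int[circle]_th \sum_(a : {ffun 'I_n -> 'I_s})
    Re ((\prod_(j < n) T (a j)) * cexpi ((N a)%:~R * th))).
  apply: eq_Rintegral => th _.
  rewrite -[X in _ ^+ X]card_ord -prodr_const bigA_distr_bigA raddf_sum/=.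
  apply: eq_bigr => a _; congr Re; rewrite big_split/=; congr (_ * _).
  rewrite -(big_morph _ cexpiD cexpi0); congr cexpi.
  by rewrite -mulr_suml /N rmorph_sum.
rewrite bm_Rintegral_sum; last first.
  move=> a; apply: proj1; apply: cbmM => //.
  by split; exact: bm_cst.
rewrite mulr_sumr [RHS]big_mkcond/=; apply: eq_bigr => a _.
rewrite cintegral_ReM// cintegral_circle /neutral -/(N a).
by case: eqP => _; rewrite ?mulr0//; case: (\prod_(j < n) _) => x y /=;
  rewrite mulr0 subr0 mulrC.
Qed.

(** Multiplying by [cos (k th)] averages the coefficients at the frequencies [l + k] and [l - k], so
    signs survive in every power of the exponent; this needs the induction for all [l] at once. It
    yields the sign of [eta_hat] and the vanishing of the sine coefficients. *)
Lemma fourier_exp_cos (I : Type) (r : seq I) (k : I -> int) (c : I -> R) (m : int) :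
  (forall i, 0 <= c i) ->
  let W th := expR (\sum_(i <- r) c i * cos ((k i)%:~R * th)) in
  0 <= \int[circle]_th (cos (m%:~R * th) * W th) /\
  \int[circle]_th (sin (m%:~R * th) * W th) = 0.
Proof.
move=> c0 W; pose S (th : measurableTypeR R) := \sum_(i <- r) c i * cos ((k i)%:~R * th).
have bcos (l : int) : bounded_measurable (fun th : measurableTypeR R => cos (l%:~R * th)).
  exact: bm_cos.
have bsin (l : int) : bounded_measurable (fun th : measurableTypeR R => sin (l%:~R * th)).
  exact: bm_sin.
have bS : bounded_measurable S by apply: bm_sum => i; exact: bmZ.
have P n : forall l : int, 0 <= \int[circle]_th (cos (l%:~R * th) * S th ^+ n) /\
    \int[circle]_th (sin (l%:~R * th) * S th ^+ n) = 0.
  elim: n => [|n ih] l.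
    under eq_Rintegral do rewrite mulr1; under [X in _ /\ X = _]eq_Rintegral do rewrite mulr1.
    rewrite circle_cos circle_sin; split=> //.
    by case: eqP => // _; rewrite mulr_ge0 ?pi_ge0.
  have bn := bmX n bS.
  split.
    have -> : \int[circle]_th (cos (l%:~R * th) * S th ^+ n.+1) =
      \sum_(i <- r) (c i / 2) * (\int[circle]_th (cos ((l + k i)%:~R * th) * S th ^+ n) +
                  \int[circle]_th (cos ((l - k i)%:~R * th) * S th ^+ n)).
      under [RHS]eq_bigr do (rewrite -bm_RintegralD; [|exact: bmM..]).
      under [RHS]eq_bigr do (rewrite -bm_RintegralZl; last by apply: bmD; exact: bmM).
      rewrite -bm_Rintegral_sum; last by move=> i; apply: bmZ; apply: bmD; exact: bmM.
      apply: eq_Rintegral => th _; rewrite exprS mulrCA mulr_suml.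
      apply: eq_bigr => i _; rewrite rmorphD rmorphB/= mulrDl mulrBl cosD cosB; by field.
    apply: sumr_ge0 => i _; rewrite mulr_ge0 ?divr_ge0//.
    by rewrite addr_ge0//; case: (ih (l + k i)); case: (ih (l - k i)).
  transitivity
      (\sum_(i <- r) (c i / 2) * (\int[circle]_th (sin ((l + k i)%:~R * th) * S th ^+ n) +
                  \int[circle]_th (sin ((l - k i)%:~R * th) * S th ^+ n))).
    under [RHS]eq_bigr do (rewrite -bm_RintegralD; [|exact: bmM..]).
    under [RHS]eq_bigr do (rewrite -bm_RintegralZl; last by apply: bmD; exact: bmM).
    rewrite -bm_Rintegral_sum; last by move=> i; apply: bmZ; apply: bmD; exact: bmM.
    apply: eq_Rintegral => th _; rewrite exprS mulrCA mulr_suml.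
    apply: eq_bigr => i _; rewrite rmorphD rmorphB/= mulrDl mulrBl sinD sinB; by field.
  by rewrite big1// => i _; rewrite (ih (l + k i)).2 (ih (l - k i)).2 addr0 mulr0.
split.
  have h := exp_moments_cvg (mu := circle) (bcos m) bS.
  apply: (cvgr_to_ge h).
  by apply: nearW => n; apply: sumr_ge0 => i _; rewrite mulr_ge0 ?invr_ge0//; case: (P i m).
apply: (cvg_unique _ (exp_moments_cvg (mu := circle) (bsin m) bS)) => //.
have -> : (fun n : nat => \sum_(0 <= i < n) i`!%:R^-1 *
    (\int[circle]_w (sin (m%:~R * w) * S w ^+ i))) = (fun=> 0).
  by apply/funext => n; rewrite big1// => i _; rewrite (P i m).2 mulr0.
exact: cvg_cst.
Qed.

End Circle.

(** With [G = F / F 0] and [A = t^2 M / (2 F 0)], iteration gives [G t >= (1 - A / N)^N] for large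
    [N = 2^n], hence [G t >= exp (- A)] in the limit, and [exp (c - A) >= 1 + c - A]. The free [c]
    will be [t^2 u0 / 2]. *)
Lemma gaussian_lower_bound {R : realType} (F : R -> R) (M : R) :
  (forall t, F t ^+ 2 = F (Num.sqrt 2 * t) * F 0) -> 0 < F 0 -> 0 <= M ->
  (forall t, F 0 - t ^+ 2 / 2 * M <= F t) ->
  forall t c, F 0 * (1 + c) - t ^+ 2 / 2 * M <= F t * expR c.
Proof.
move=> F2 F0 M0 Fl t c.
have s0 : 0 < Num.sqrt 2 :> R by rewrite sqrtr_gt0.
have s2 : Num.sqrt 2 ^+ 2 = 2 :> R by rewrite sqr_sqrtr.
pose G s := F s / F 0.
have G2 s : G s = G (s / Num.sqrt 2) ^+ 2.
  rewrite /G expr_div_n F2 (_ : Num.sqrt 2 * (s / Num.sqrt 2) = s).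
    by field; rewrite gt_eqF.
  by field; rewrite gt_eqF.
pose A := t ^+ 2 / 2 * (M / F 0).
have A0 : 0 <= A by apply: mulr_ge0; rewrite divr_ge0 ?sqr_ge0// ltW.
have Gn n : G t = G (t / Num.sqrt 2 ^+ n) ^+ (2 ^ n).
  elim: n => [|n ih]; first by rewrite expr0 divr1 expn0 expr1.
  by rewrite ih G2 expnS exprM (exprSr (Num.sqrt 2) n) invfM mulrA.
have key n : A < (2 ^ n)%:R -> 1 + c - A - A ^+ 2 / ((2 ^ n)%:R - A) <= G t * expR c.
  set N := (2 ^ n)%:R => AN.
  have N0 : 0 < N by rewrite ltr0n expn_gt0.
  (* Chosen so that [1 - A / N] is the inverse of [1 + y]; then [1 + y <= exp y] bounds the [N]-th
     power below by [exp (- N y)], where [N y = A + A^2 / (N - A)]. *)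
  pose y := A / (N - A).
  have NA : 0 < N - A by rewrite subr_gt0.
  have y0 : 0 <= y by rewrite /y divr_ge0// ltW.
  have G1 : (1 + y)^-1 <= G (t / Num.sqrt 2 ^+ n).
    have -> : (1 + y)^-1 = 1 - A / N.
      rewrite /y; field; rewrite !gt_eqF//=.
    rewrite /G ler_pdivlMr//.
    apply: le_trans (Fl _); rewrite expr_div_n -exprM mulnC exprM s2 -natrX -/N /A.
    rewrite le_eqVlt; apply/orP; left; apply/eqP; field.
    by rewrite !gt_eqF.
  have -> : 1 + c - A - A ^+ 2 / (N - A) = 1 + (c - N * y).
    by rewrite /y; field; rewrite gt_eqF.
  apply: le_trans (expR_ge1Dx _) _; rewrite addrC expRD ler_pM2r ?expR_gt0//.
  rewrite (Gn n); apply: (@le_trans _ _ ((1 + y)^-1 ^+ (2 ^ n))); last first.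
    by rewrite lerXn2r// ?nnegrE ?invr_ge0 ?addr_ge0//; apply: le_trans G1; rewrite invr_ge0 addr_ge0.
  rewrite expRN expRM_natl exprVn lef_pV2 ?posrE ?exprn_gt0 ?expR_gt0 ?ltr_wpDr//.
  by rewrite lerXn2r// ?nnegrE ?expR_ge0 ?addr_ge0// expR_ge1Dx.
have main : 1 + c - A <= G t * expR c.
  apply/ler_addgt0Pr => eps e0.
  (* Makes [N = 2^(n+1)] exceed [A + A^2 / eps], so that the error [A^2 / (N - A)] is at most
     [eps]. *)
  pose n := Num.trunc (A + A ^+ 2 / eps).
  have h : A + A ^+ 2 / eps < (2 ^ n.+1)%:R.
    apply: lt_le_trans (truncnS_gt _) _.
    by rewrite ler_nat ltnW// ltn_expl.
  have AN : A < (2 ^ n.+1)%:R.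
    by apply: le_lt_trans h; rewrite lerDl divr_ge0 ?sqr_ge0 ?ltW.
  have := key _ AN; set N := (2 ^ n.+1)%:R in AN h *.
  suff : A ^+ 2 / (N - A) <= eps by lra.
  rewrite ler_pdivrMr ?subr_gt0// mulrC -ler_pdivrMr//; lra.
have -> : F 0 * (1 + c) - t ^+ 2 / 2 * M = F 0 * (1 + c - A).
  by rewrite /A; field; rewrite gt_eqF.
have -> : F t * expR c = F 0 * (G t * expR c).
  by rewrite /G; field; rewrite gt_eqF.
by rewrite ler_pM2l.
Qed.

(** * Trigonometric approximation of the square *)

Section QuadraticApproximation.
Context {R : realType}.

(** This is [(2^(k+1) sin (y / 2^(k+1)))^2]. It is bounded, increases to [y^2], and is affine in a
    cosine, so its expectation is given by the characteristic function. *)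
Definition sqr_approx (k : nat) (y : R) : R := 2 * 4 ^+ k * (1 - cos (y / 2 ^+ k)).

Lemma sqr_approx_ge0 k y : 0 <= sqr_approx k y.
Proof. by rewrite /sqr_approx !mulr_ge0 ?exprn_ge0// subr_ge0 cos_le1. Qed.

Lemma sqr_approx_nd y : nondecreasing_seq (sqr_approx ^~ y).
Proof.
apply/nondecreasing_seqP => k; rewrite /sqr_approx.
have -> : y / 2 ^+ k = y / 2 ^+ k.+1 + y / 2 ^+ k.+1.
  by rewrite exprS; field; rewrite expf_neq0.
set x := y / 2 ^+ k.+1; rewrite cosD -!expr2 sin2cos2 (exprS 4 k).
have c1 : cos x <= 1 := cos_le1 x.
have c2 : -1 <= cos x := cos_geN1 x.
have p0 : (0 : R) < 4 ^+ k by rewrite exprn_gt0.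
(* The increment from [k] to [k + 1] equals [4 * 4^k * (1 - cos x)^2]. *)
by have := mulr_ge0 (ltW p0) (sqr_ge0 (1 - cos x)); nra.
Qed.

Lemma sqr_approx_cvg y : sqr_approx k y @[k --> \oo] --> y ^+ 2.
Proof.
have -> : (fun k => sqr_approx k y) = (fun k => (2 ^+ k.+1 * sin (y / 2 ^+ k.+1)) ^+ 2).
  apply/funext => k; rewrite /sqr_approx.
  have -> : y / 2 ^+ k = y / 2 ^+ k.+1 + y / 2 ^+ k.+1.
    by rewrite exprS; field; rewrite expf_neq0.
  rewrite cosD -!expr2 exprMn -exprM mulnC exprM cos2sin2.
  rewrite (_ : 2 ^+ 2 = 4 :> R) ?(exprS 4 k); first ring.
  by rewrite -natrX.
rewrite expr2; under eq_fun do rewrite expr2.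
suff h : 2 ^+ k.+1 * sin (y / 2 ^+ k.+1) @[k --> \oo] --> y by exact: cvgM.
(* The limit is the derivative at 0 of [sin (h y)], a difference quotient taken along
   [h = 2^-(k+1)]. *)
have dS : is_derive (0 : R) 1 (fun h : R => sin (h * y)) (1 *: (y *: cos (0 * y))).
  apply: is_derive_eq; rewrite /GRing.scale/=; ring.
have [/cvg_ex[l /= lE] lv] := dS.
move: (lE) => /cvg_lim El; move: lv; rewrite /derive/= El// => {}El.
have {}lE : h^-1 *: (sin ((h *: 1 + 0) * y) - sin (0 * y)) @[h --> (0:R)^'] --> y.
  by move: lE; rewrite El mul0r cos0 /GRing.scale/= mulr1 mul1r.
have u0 : (2^-1 : R) ^+ k.+1 @[k --> \oo] --> (0 : R)^'.
  have u0' : (2^-1 : R) ^+ k.+1 @[k --> \oo] --> (0 : R).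
    rewrite (cvg_shiftS (fun k => (2^-1 : R) ^+ k)); apply: cvg_expr.
    by rewrite ger0_norm// invf_lt1// ltr1n.
  move=> S hS; have hS' : nbhs (0 : R) [set x | x != 0 -> S x] := hS.
  have [N _ hN] := u0' _ hS'; exists N => // k Nk.
  by apply: (hN k Nk); rewrite expf_neq0.
have := cvg_comp _ _ u0 lE.
apply: cvg_trans; apply: near_eq_cvg; apply: nearW => k /=.
by rewrite mul0r sin0 subr0 addr0 /GRing.scale/= mulr1 exprVn invrK [X in _ * sin X]mulrC.
Qed.

Lemma sqr_approx_le k y : sqr_approx k y <= y ^+ 2.
Proof.
apply: (cvgr_to_ge (@sqr_approx_cvg y)); exists k => // n /= kn.
exact: sqr_approx_nd.
Qed.

Lemma one_sub_cos_le (y : R) : 1 - cos y <= y ^+ 2 / 2.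
Proof. by have := sqr_approx_le 0 y; rewrite /sqr_approx expr0 divr1; lra. Qed.

End QuadraticApproximation.

Lemma fine_expeRND {R : realType} (a b : \bar R) : (0 <= a)%E -> (0 <= b)%E ->
  fine (expeR (- (a + b))) = fine (expeR (- a)) * fine (expeR (- b)).
Proof.
by case: a b => [a| |] [b| |]//= _ _; rewrite ?mul0r ?mulr0// opprD expRD.
Qed.

(** * The damping factor *)

Section QuadraticDamping.
Context {R : realType} {d : measure_display} {X : measurableType d}.
Variable nu : {finite_measure set X -> \bar R}.
Variable a : R.
Hypothesis a_ge0 : 0 <= a.

Definition qform (y : X -> R) : \bar R := (\int[nu]_x (a * y x ^+ 2)%:E)%E.

(** With [a] half of [xi0_inv2], this is [exp (- V_2)] up to the constant coming from [u0]. An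
    infinite form gives damping 0. *)
Definition damping (y : X -> R) : R := fine (expeR (- qform y)).

Definition damping_approx (k : nat) (y : X -> R) : R :=
  expR (- \int[nu]_x (a * sqr_approx k (y x))).

Lemma qform_ge0 y : (0 <= qform y)%E.
Proof. by apply: integral_ge0 => x _; rewrite lee_fin mulr_ge0 ?sqr_ge0. Qed.

Lemma damping_ge0 y : 0 <= damping y.
Proof. by rewrite /damping; case: (qform y) => [r| |]//=; rewrite expR_ge0. Qed.

Lemma damping_le1 y : damping y <= 1.
Proof.
rewrite /damping; have := qform_ge0 y; case: (qform y) => [r| |]//=.
by rewrite lee_fin => r0; rewrite -[leRHS]expR0 ler_expR oppr_le0.
Qed.

Lemma bm_sqr_approx k : bounded_measurable (sqr_approx k : measurableTypeR R -> R).
Proof.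
apply: bmZ; apply: bmB; first exact: bm_cst.
by apply: bm_cos; apply: measurable_funM.
Qed.

Lemma bm_damping_integrand k (y : X -> R) : measurable_fun setT y ->
  bounded_measurable (fun x => a * sqr_approx k (y x)).
Proof.
move=> my; apply: bmZ; exact: (bm_comp my (bm_sqr_approx k)).
Qed.

Lemma damping_approx_ge0 k y : 0 <= damping_approx k y.
Proof. exact: expR_ge0. Qed.

Lemma damping_approx_le1 k y : damping_approx k y <= 1.
Proof.
rewrite -[leRHS]expR0 ler_expR oppr_le0 Rintegral_ge0// => x _.
by rewrite mulr_ge0// sqr_approx_ge0.
Qed.

Lemma damping_approx_cvg y : measurable_fun setT y ->
  damping_approx k y @[k --> \oo] --> damping y.
Proof.
move=> my.
have : (\int[nu]_x (a * sqr_approx k (y x))%:E)%E @[k --> \oo] --> qform y.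
  have e x : (a * sqr_approx k (y x))%:E @[k --> \oo] --> (a * y x ^+ 2)%:E.
    apply: cvg_EFin; first exact: nearW.
    by apply: cvgM; [exact: cvg_cst | exact: sqr_approx_cvg].
  have := @cvg_monotone_convergence _ _ _ nu setT measurableT
    (fun k x => (a * sqr_approx k (y x))%:E).
  under [X in _ -> _ -> _ -> _ --> X]eq_integral do rewrite (cvg_lim _ (e _))//.
  apply.
  - by move=> k; apply/measurable_EFinP; case: (bm_damping_integrand k my).
  - by move=> k x _; rewrite lee_fin mulr_ge0// sqr_approx_ge0.
  - by move=> x _ m n mn; rewrite lee_fin ler_wpM2l// sqr_approx_nd.
under eq_fun do rewrite (bm_RintegralE nu (bm_damping_integrand _ my)).
rewrite /damping /damping_approx.
have := qform_ge0 y; case: (qform y) => [r| |]//= _ h.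
  apply: continuous_cvg; first exact: continuous_expR.
  by apply: cvgN; move/fine_cvgP : h => [].
(* Infinite form: the approximating integrals eventually exceed [- ln e], so their damping falls
   below [e]. *)
move/cvgeryP : h => h; apply/cvgrPdist_le => e e0.
have : \forall k \near \oo, - ln e <= \int[nu]_x (a * sqr_approx k (y x)).
  by move/cvgryPge : h; apply.
apply: filterS => k hk; rewrite sub0r normrN ger0_norm ?expR_ge0//.
by rewrite -[leRHS]lnK ?posrE// ler_expR lerNl.
Qed.

Lemma bm_damping_approx {dO} {O : measurableType dO} k (Y : O * X -> R) :
  measurable_fun setT Y ->
  bounded_measurable (fun w => damping_approx k (fun x => Y (w, x))).
Proof.
move=> mY; apply: bm_exp; apply: bmN.
have bY : bounded_measurable (fun p => a * sqr_approx k (Y p)).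
  by apply: bmZ; exact: (bm_comp mY (bm_sqr_approx k)).
(* The Dirac mass only supplies some finite measure on [O], which the measurability of a parametric
   integral was derived with. *)
split; last by case: (bm_Rintegral2 (\d_ (point : O)) nu bY).
by case: (bm_Rintegral2 (\d_ (point : O)) nu bY).
Qed.

Lemma bm_damping {dO} {O : measurableType dO} (Y : O * X -> R) :
  measurable_fun setT Y ->
  bounded_measurable (fun w => damping (fun x => Y (w, x))).
Proof.
move=> mY; split; last first.
  by exists 1 => w; rewrite ger0_norm ?damping_ge0// damping_le1.
apply: (measurable_fun_cvg (fun k => (bm_damping_approx k mY).1)) => w _.
by apply: damping_approx_cvg; apply: measurableT_comp mY _; exact: pair1_measurable.
Qed.

Lemma qformD (y1 y2 : X -> R) : measurable_fun setT y1 -> measurable_fun setT y2 ->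
  (qform y1 + qform y2 = \int[nu]_x (a * (y1 x ^+ 2 + y2 x ^+ 2))%:E)%E.
Proof.
have mm (y : X -> R) : measurable_fun setT y ->
    measurable_fun setT (fun x => (a * y x ^+ 2)%:E).
  by move=> my; apply/measurable_EFinP; apply: measurable_funM => //; exact: measurable_funX.
have pp (y : X -> R) x : (0 <= (a * y x ^+ 2)%:E)%E.
  by rewrite lee_fin mulr_ge0 ?sqr_ge0.
move=> m1 m2; rewrite -ge0_integralD//; try exact: mm.
by apply: eq_integral => x _; rewrite mulrDr EFinD.
Qed.

(** Both products are the exponential of minus a sum of two forms, including when a form is
    infinite. The identity is pointwise in the fields. *)
Lemma damping_parallelogram (y1 y2 u1 u2 : X -> R) :
  measurable_fun setT y1 -> measurable_fun setT y2 ->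
  measurable_fun setT u1 -> measurable_fun setT u2 ->
  (forall x, y1 x ^+ 2 + y2 x ^+ 2 = u1 x ^+ 2 + u2 x ^+ 2) ->
  damping y1 * damping y2 = damping u1 * damping u2.
Proof.
move=> m1 m2 n1 n2 E; rewrite -!fine_expeRND ?qform_ge0//.
by rewrite !qformD//; under eq_integral do rewrite E.
Qed.

End QuadraticDamping.

(** * Rotation invariance of two independent copies *)

Section GaussianRotation.
Context {R : realType} {d dO : measure_display}.
Context {X : measurableType d} {O : measurableType dO}.
Variables (P : probability O R) (Y : O -> X -> R) (K : X -> X -> R).
Hypothesis mY : measurable_fun setT (fun p : O * X => Y p.1 p.2).
Hypothesis gaussY : centered_gaussian_process P Y K.

Let P2 : probability (O * O)%type R := (P \x P)%E.
Let r2 : R := (Num.sqrt 2)^-1.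
Let r2E : r2 * r2 = 2^-1.
Proof. by rewrite /r2 -invfM -expr2 sqr_sqrtr. Qed.

Let Y1 (w : O * O) x := Y w.1 x.
Let Y2 (w : O * O) x := Y w.2 x.
Let U w x := r2 * (Y1 w x + Y2 w x).
Let V w x := r2 * (Y1 w x - Y2 w x).

Let mYx x : measurable_fun setT (Y ^~ x).
Proof. exact: (measurable_section2 x mY). Qed.

Let mY1 : measurable_fun setT (fun p : (O * O) * X => Y1 p.1 p.2).
Proof.
have m : measurable_fun setT (fun p : (O * O) * X => (p.1.1, p.2)).
  apply: measurable_fun_pair; last exact: measurable_snd.
  exact: (measurableT_comp measurable_fst measurable_fst).
exact: (measurableT_comp mY m).
Qed.

Let mY2 : measurable_fun setT (fun p : (O * O) * X => Y2 p.1 p.2).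
Proof.
have m : measurable_fun setT (fun p : (O * O) * X => (p.1.2, p.2)).
  apply: measurable_fun_pair; last exact: measurable_snd.
  exact: (measurableT_comp measurable_snd measurable_fst).
exact: (measurableT_comp mY m).
Qed.

Let mU : measurable_fun setT (fun p : (O * O) * X => U p.1 p.2).
Proof. exact: (measurable_funM (measurable_cst _) (measurable_funD mY1 mY2)). Qed.

Let mV : measurable_fun setT (fun p : (O * O) * X => V p.1 p.2).
Proof. exact: (measurable_funM (measurable_cst _) (measurable_funB mY1 mY2)). Qed.

Let sec (A : O * O -> X -> R) x :
  measurable_fun setT (fun p : (O * O) * X => A p.1 p.2) ->
  measurable_fun setT (A ^~ x).
Proof. exact: measurable_section2. Qed.

(** An entry holds the coefficient of [A], that of [B], and a point. Sequences are used so that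
    adding phases is concatenation. *)
Definition phase (A B : O * O -> X -> R) (p : seq (R * R * X)) w : R :=
  \sum_(i <- p) (i.1.1 * A w i.2 + i.1.2 * B w i.2).

Let bphase A B p :
  measurable_fun setT (fun p : (O * O) * X => A p.1 p.2) ->
  measurable_fun setT (fun p : (O * O) * X => B p.1 p.2) ->
  measurable_fun setT (phase A B p).
Proof.
move=> mA mB; apply: measurable_bigsum => i.
apply: (measurable_funD (measurable_funM (measurable_cst _) _)
                        (measurable_funM (measurable_cst _) _)); exact: sec.
Qed.

Let cov (h : R * R -> R) (p : seq (R * R * X)) : R :=
  \sum_(i <- p) \sum_(j <- p) h i.1 * h j.1 * K i.2 j.2.

Let mlin (h : R * R -> R) p : measurable_fun setT (fun w => \sum_(i <- p) h i.1 * Y w i.2).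
Proof.
apply: measurable_bigsum => i; exact: (measurable_funM (measurable_cst _) (mYx _)).
Qed.

Let gauss_seq (h : R * R -> R) (p : seq (R * R * X)) :
  \int[P]_w cos (\sum_(i <- p) h i.1 * Y w i.2) = expR (- 2^-1 * cov h p) /\
  \int[P]_w sin (\sum_(i <- p) h i.1 * Y w i.2) = 0.
Proof.
have [E1 E2] := gaussY (fun j => (tnth (in_tuple p) j).2)
  (fun j => h (tnth (in_tuple p) j).1).
split; apply: EFin_inj.
  rewrite -bm_RintegralE; last exact: bm_cos (mlin h p).
  under eq_integral do rewrite big_tnth.
  rewrite E1 /cov [in RHS]big_tnth; congr (expR (_ * _))%:E.
  by apply: eq_bigr => i _; rewrite [RHS]big_tnth.
rewrite -bm_RintegralE; last exact: bm_sin (mlin h p).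
by under eq_integral do rewrite big_tnth.
Qed.

Let RintP2 (f : O * O -> R) : bounded_measurable f ->
  \int[P2]_w f w = \int[P]_w1 \int[P]_w2 f (w1, w2).
Proof. exact: bm_Rintegral_prod. Qed.

Lemma phase_char p :
  \int[P2]_w cos (phase Y1 Y2 p w) = expR (- 2^-1 * (cov fst p + cov snd p)).
Proof.
rewrite RintP2; last by apply: bm_cos; exact: bphase.
have [c1 s1] := gauss_seq fst p; have [c2 s2] := gauss_seq snd p.
transitivity (\int[P]_w1 (cos (\sum_(i <- p) i.1.1 * Y w1 i.2) *
    expR (- 2^-1 * cov snd p))).
  apply: eq_Rintegral => w1 _.
  have bc := bm_cos (mlin snd p); have bs := bm_sin (mlin snd p).
  transitivity (\int[P]_w2 (
      cos (\sum_(i <- p) i.1.1 * Y w1 i.2) * cos (\sum_(i <- p) i.1.2 * Y w2 i.2) -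
      sin (\sum_(i <- p) i.1.1 * Y w1 i.2) * sin (\sum_(i <- p) i.1.2 * Y w2 i.2))).
    by apply: eq_Rintegral => w2 _; rewrite /phase big_split/= cosD.
  rewrite bm_RintegralB; [|exact: bmZ..].
  by rewrite !bm_RintegralZl// c2 s2 mulr0 subr0.
rewrite bm_RintegralZr; last exact: bm_cos (mlin fst p).
by rewrite c1 -expRD mulrDr.
Qed.

Lemma phase_rotate p : phase U V p =
  phase Y1 Y2 [seq ((r2 * (i.1.1 + i.1.2), r2 * (i.1.1 - i.1.2)), i.2) | i <- p].
Proof.
apply/funext => w; rewrite /phase big_map; apply: eq_bigr => i _ /=.
rewrite /U /V; ring.
Qed.

(** The cross terms cancel: [(c + c') (e + e') + (c - c') (e - e') = 2 (c e + c' e')], and [r2 ^ 2]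
    absorbs the 2. *)
Lemma phase_char_rotate p :
  \int[P2]_w cos (phase Y1 Y2 p w) = \int[P2]_w cos (phase U V p w).
Proof.
rewrite phase_rotate !phase_char; congr (expR (_ * _)).
rewrite /cov -!big_split/= big_map; apply: eq_bigr => i _.
rewrite -!big_split/= big_map; apply: eq_bigr => j _ /=.
set c := i.1.1; set c' := i.1.2; set e := j.1.1; set e' := j.1.2.
transitivity (2 * (r2 * r2) * (c * e * K i.2 j.2 + c' * e' * K i.2 j.2)); last by ring.
by rewrite r2E mulfV// mul1r.
Qed.

(** A weak form of: [H1] depends on [(Y1, Y2)] as [H2] depends on [(U, V)]. Testing against every
    cosine of a phase, rather than comparing plain expectations, makes the relation stable under
    multiplication by cosines. *)
Definition corr (H1 H2 : O * O -> R) :=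
  [/\ bounded_measurable H1, bounded_measurable H2 & forall p,
  \int[P2]_w (H1 w * cos (phase Y1 Y2 p w)) = \int[P2]_w (H2 w * cos (phase U V p w))].

Let bY p : bounded_measurable (fun w => cos (phase Y1 Y2 p w)).
Proof. by apply: bm_cos; exact: bphase. Qed.

Let bU p : bounded_measurable (fun w => cos (phase U V p w)).
Proof. by apply: bm_cos; exact: bphase. Qed.

Lemma corr1 : corr (fun=> 1) (fun=> 1).
Proof.
split; try exact: bm_cst.
by move=> p; under eq_Rintegral do rewrite mul1r;
  under [RHS]eq_Rintegral do rewrite mul1r; exact: phase_char_rotate.
Qed.

Lemma corrD H1 H2 G1 G2 : corr H1 H2 -> corr G1 G2 ->
  corr (fun w => H1 w + G1 w) (fun w => H2 w + G2 w).
Proof.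
move=> [b1 b2 E] [c1 c2 F]; split; try exact: bmD.
move=> p; under eq_Rintegral do rewrite mulrDl.
under [RHS]eq_Rintegral do rewrite mulrDl.
by rewrite !bm_RintegralD ?E ?F//; exact: bmM.
Qed.

Lemma corrZ c H1 H2 : corr H1 H2 -> corr (fun w => c * H1 w) (fun w => c * H2 w).
Proof.
move=> [b1 b2 E]; split; try exact: bmZ.
move=> p; under eq_Rintegral do rewrite -mulrA.
under [RHS]eq_Rintegral do rewrite -mulrA.
by rewrite !bm_RintegralZl ?E//; exact: bmM.
Qed.

Lemma corr_cos r H1 H2 : corr H1 H2 ->
  corr (fun w => H1 w * cos (phase Y1 Y2 r w)) (fun w => H2 w * cos (phase U V r w)).
Proof.
move=> [b1 b2 E]; split; try exact: bmM.
(* With [p'] the phase opposite to [p], a product of two cosines is half the sum of the cosines of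
   [r ++ p] and [r ++ p']; no sine ever enters. *)
move=> p; pose p' := [seq ((- i.1.1, - i.1.2), i.2) | i <- p] : seq (R * R * X).
have ph A B w : phase A B (r ++ p) w = phase A B r w + phase A B p w.
  by rewrite /phase big_cat.
have ph' A B w : phase A B (r ++ p') w = phase A B r w - phase A B p w.
  rewrite /phase big_cat big_map/=; congr (_ + _).
  by rewrite -sumrN; apply: eq_bigr => i _ /=; ring.
have cc (x y : R) : cos x * cos y = 2^-1 * (cos (x + y) + cos (x - y)).
  by rewrite cosD cosB; field.
under eq_Rintegral do rewrite -mulrA cc -ph -ph' mulrCA mulrDr.
under [RHS]eq_Rintegral do rewrite -mulrA cc -ph -ph' mulrCA mulrDr.
rewrite !bm_RintegralZl; try by apply: bmD; exact: bmM.
by rewrite !bm_RintegralD ?E//; exact: bmM.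
Qed.

Let cos2 (A B : O * O -> X -> R) (t : R) x w := cos (t * A w x) + cos (t * B w x).

Lemma corr_cos2 t x H1 H2 : corr H1 H2 ->
  corr (fun w => H1 w * cos2 Y1 Y2 t x w) (fun w => H2 w * cos2 U V t x w).
Proof.
move=> c; have := corrD (corr_cos [:: ((t, 0), x)] c) (corr_cos [:: ((0, t), x)] c).
have ph1 A B w : phase A B [:: ((t, 0), x)] w = t * A w x.
  by rewrite /phase big_seq1/= mul0r addr0.
have ph2 A B w : phase A B [:: ((0, t), x)] w = t * B w x.
  by rewrite /phase big_seq1/= mul0r add0r.
rewrite /cos2; congr corr; apply/funext => w; rewrite ph1 ph2; ring.
Qed.

Variables (v : {measure set X -> \bar R}) (Lam : set X).
Hypotheses (mLam : measurable Lam) (finLam : (v Lam < +oo)%E).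
Let nu := vrestr mLam finLam.

(** Compared moment by moment: the [n]-th moment is an iterated integral over [n] points of the
    expectation of a product of [n] factors [b * cos2], and [corr] survives each factor. *)
Lemma corr_exp (b t : R) (x0 : X) H1 H2 : corr H1 H2 ->
  \int[P2]_w (H1 w * expR (\int[nu]_x (b * cos2 Y1 Y2 t x w))) =
  \int[P2]_w (H2 w * expR (\int[nu]_x (b * cos2 U V t x w))).
Proof.
move=> c12; have [bH1 bH2 _] := c12.
pose G1 (p : (O * O) * X) := b * cos2 Y1 Y2 t p.2 p.1.
pose G2 (p : (O * O) * X) := b * cos2 U V t p.2 p.1.
have bG1 : bounded_measurable G1.
  by apply: bmZ; apply: bmD; apply: bm_cos; exact: measurable_funM.
have bG2 : bounded_measurable G2.
  by apply: bmZ; apply: bmD; apply: bm_cos; exact: measurable_funM.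
have b1 := bm_Rintegral2 P2 nu bG1; have b2 := bm_Rintegral2 P2 nu bG2.
have mom n : \int[P2]_w (H1 w * (\int[nu]_x G1 (w, x)) ^+ n) =
             \int[P2]_w (H2 w * (\int[nu]_x G2 (w, x)) ^+ n).
  apply: EFin_inj.
  rewrite -(iter_int_Rintegral mLam finLam P2 x0 n bG1 bH1).
  rewrite -(iter_int_Rintegral mLam finLam P2 x0 n bG2 bH2).
  congr iter_int; apply/funext => xs; congr EFin.
  suff [_ _ /(_ [::])] : corr (fun w => H1 w * \prod_(j < n) G1 (w, nth x0 xs j))
      (fun w => H2 w * \prod_(j < n) G2 (w, nth x0 xs j)).
    rewrite /phase; under eq_Rintegral do rewrite big_nil cos0 mulr1.
    by under [in X in _ = X -> _]eq_Rintegral do rewrite big_nil cos0 mulr1.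
  elim: n => [|n ih].
    by under eq_fun do rewrite big_ord0 mulr1;
       under [X in corr _ X]eq_fun do rewrite big_ord0 mulr1.
  have := corrZ b (corr_cos2 t (nth x0 xs n) ih).
  by congr corr; apply/funext => w; rewrite big_ord_recr/= /G1 /G2 /=; ring.
apply: (cvg_unique _ (exp_moments_cvg (mu := P2) bH1 b1)) => //.
have -> : (fun n : nat => \sum_(0 <= k < n)
      k`!%:R^-1 * \int[P2]_w (H1 w * (\int[nu]_y G1 (w, y)) ^+ k)) =
    (fun n : nat => \sum_(0 <= k < n)
      k`!%:R^-1 * \int[P2]_w (H2 w * (\int[nu]_y G2 (w, y)) ^+ k)).
  by apply/funext => n; apply: eq_bigr => k _; rewrite mom.
exact: (exp_moments_cvg (mu := P2) bH2 b2).
Qed.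

Variable a : R.
Hypothesis a_ge0 : 0 <= a.

Let mA1 (A : O * O -> X -> R) w :
  measurable_fun setT (fun p : (O * O) * X => A p.1 p.2) ->
  measurable_fun setT (A w).
Proof. exact: measurable_section1. Qed.

(** Since [sqr_approx] is affine in a cosine, the product takes the exponential form that [corr_exp]
    handles. *)
Lemma damping_approx_cos2 (A B : O * O -> X -> R) k w :
  measurable_fun setT (fun p : (O * O) * X => A p.1 p.2) ->
  measurable_fun setT (fun p : (O * O) * X => B p.1 p.2) ->
  damping_approx nu a k (A w) * damping_approx nu a k (B w) =
  expR (- (4 * a * 4 ^+ k) * fine (nu setT)) *
  expR (\int[nu]_x (2 * a * 4 ^+ k * cos2 A B (2 ^- k) x w)).
Proof.
move=> mA mB; rewrite /damping_approx -!expRD; congr expR.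
have bA := bm_damping_integrand a k (mA1 w mA).
have bB := bm_damping_integrand a k (mA1 w mB).
rewrite -opprD -bm_RintegralD// mulNr -Rintegral_cst//.
rewrite addrC -bm_RintegralB; last 2 first.
- apply: bmZ; apply: bmD; apply: bm_cos;
    exact: (measurable_funM (measurable_cst _) (mA1 w _)).
- exact: bm_cst.
apply: oppr_inj; rewrite opprK -[RHS]mulN1r -bm_RintegralZl; last first.
  apply: bmB; last exact: bm_cst.
  apply: bmZ; apply: bmD; apply: bm_cos;
    exact: (measurable_funM (measurable_cst _) (mA1 w _)).
apply: eq_Rintegral => x _; rewrite /sqr_approx /cos2 /=.
rewrite ![2 ^- k * _]mulrC; ring.
Qed.

(** An identity of expectations: at a finite level [k] the two products of approximants need not
    agree pointwise, but [corr_exp] equates their integrals, and dominated convergence with the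
    bound 2 of [cos2] gives the limit. *)
Lemma damping_rotation (x : X) (t : R) :
  \int[P2]_w (damping nu a (Y1 w) * damping nu a (Y2 w) * cos2 Y1 Y2 t x w) =
  \int[P2]_w (damping nu a (U w) * damping nu a (V w) * cos2 U V t x w).
Proof.
have lim (A B : O * O -> X -> R) :
    measurable_fun setT (fun p : (O * O) * X => A p.1 p.2) ->
    measurable_fun setT (fun p : (O * O) * X => B p.1 p.2) ->
    \int[P2]_w (damping_approx nu a k (A w) * damping_approx nu a k (B w) *
      cos2 A B t x w) @[k --> \oo] -->
    \int[P2]_w (damping nu a (A w) * damping nu a (B w) * cos2 A B t x w).
  move=> mA mB; apply: (@bm_Rintegral_cvg _ _ _ P2 _ _ 2).
  - move=> k; apply: measurable_funM.
      by apply: measurable_funM;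
        [case: (bm_damping_approx nu a k mA) | case: (bm_damping_approx nu a k mB)].
    by apply: measurable_funD;
      [case: (bm_cos (measurable_funM (measurable_cst t) (sec x mA)))
      |case: (bm_cos (measurable_funM (measurable_cst t) (sec x mB)))].
  - move=> k w; rewrite -[leRHS]mul1r normrM ler_pM//.
      rewrite normrM mulr_ile1// ger0_norm ?damping_approx_ge0//;
      exact: damping_approx_le1.
    rewrite (le_trans (ler_normD _ _))// -[leRHS]/(1 + 1) lerD//;
      by rewrite ler_norml cos_geN1 cos_le1.
  - move=> w; apply: cvgM; last exact: cvg_cst.
    by apply: cvgM; apply: damping_approx_cvg => //; exact: mA1.
apply: (cvg_unique _ (lim _ _ mY1 mY2)) => //.
have -> : (fun k => \int[P2]_w (damping_approx nu a k (Y1 w) *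
      damping_approx nu a k (Y2 w) * cos2 Y1 Y2 t x w)) =
    (fun k => \int[P2]_w (damping_approx nu a k (U w) *
      damping_approx nu a k (V w) * cos2 U V t x w)).
  apply/funext => k.
  under eq_Rintegral do rewrite damping_approx_cos2// -mulrA.
  under [RHS]eq_Rintegral do rewrite damping_approx_cos2// -mulrA.
  have bG (A B : O * O -> X -> R) :
    measurable_fun setT (fun p : (O * O) * X => A p.1 p.2) ->
    measurable_fun setT (fun p : (O * O) * X => B p.1 p.2) ->
    bounded_measurable (fun w => expR (\int[nu]_x (2 * a * 4 ^+ k *
      cos2 A B (2 ^- k) x w)) * cos2 A B t x w).
    move=> mA mB; apply: bmM; last first.
      by apply: bmD; apply: bm_cos; exact: (measurable_funM (measurable_cst _) (sec _ _)).
    apply: bm_exp.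
    have b2 : bounded_measurable (fun p : (O * O) * X => 2 * a * 4 ^+ k *
        cos2 A B (2 ^- k) p.2 p.1).
      by apply: bmZ; apply: bmD; apply: bm_cos; exact: (measurable_funM (measurable_cst _)).
    exact: (bm_Rintegral2 P2 nu b2).
  rewrite !bm_RintegralZl; [|exact: bG..]; congr (_ * _).
  have := corr_exp (2 * a * 4 ^+ k) (2 ^- k) x (corr_cos2 t x corr1).
  under eq_Rintegral do rewrite mul1r mulrC.
  by under [in X in _ = X -> _]eq_Rintegral do rewrite mul1r mulrC.
exact: lim.
Qed.

Lemma Rintegral_P2M (f g : O -> R) : bounded_measurable f -> bounded_measurable g ->
  \int[P2]_w (f w.1 * g w.2) = (\int[P]_w f w) * (\int[P]_w g w).
Proof.
move=> bf bg; rewrite RintP2; last first.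
  by apply: bmM; [exact: (bm_comp measurable_fst bf) | exact: (bm_comp measurable_snd bg)].
rewrite -bm_RintegralZr//; apply: eq_Rintegral => w1 _.
by rewrite -bm_RintegralZl.
Qed.

(* Maxwell's characterization of Gaussian laws for the damped measure: the
   parallelogram law makes the damping invariant under the rotation. *)
Lemma damped_char_sqr (x : X) (t : R) :
  let F s := \int[P]_w (damping nu a (Y w) * cos (s * Y w x)) in
  F t ^+ 2 = F (Num.sqrt 2 * t) * F 0.
Proof.
move=> F.
have bD : bounded_measurable (fun w => damping nu a (Y w)) by exact: (bm_damping nu a_ge0 mY).
have bF s : bounded_measurable (fun w => damping nu a (Y w) * cos (s * Y w x)).
  by apply: bmM => //; apply: bm_cos; exact: (measurable_funM (measurable_cst _) (mYx x)).
have s2 : Num.sqrt 2 * r2 = 1 :> R by rewrite /r2 mulfV// gt_eqF// sqrtr_gt0.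
have mm (w : O * O) : damping nu a (Y1 w) * damping nu a (Y2 w) =
    damping nu a (U w) * damping nu a (V w).
  apply: damping_parallelogram => //; try exact: mA1.
  move=> z; transitivity (2 * (r2 * r2) * (Y1 w z ^+ 2 + Y2 w z ^+ 2)).
    by rewrite r2E mulfV// mul1r.
  by rewrite /U /V; ring.
suff : 2 * F t ^+ 2 = 2 * (F (Num.sqrt 2 * t) * F 0).
  by move/mulfI; apply; rewrite pnatr_eq0.
have bP s r : bounded_measurable (fun w : O * O =>
    damping nu a (Y w.1) * cos (s * Y w.1 x) * (damping nu a (Y w.2) * cos (r * Y w.2 x))).
  by apply: bmM; [exact: (bm_comp measurable_fst (bF s)) | exact: (bm_comp measurable_snd (bF r))].
(* [2 cos (t Y1) cos (t Y2)] is the sum of the cosines of [sqrt 2 t U] and [sqrt 2 t V], and [mm]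
   rewrites the damping pointwise. Returning to [(Y1, Y2)] by [damping_rotation], the expectation
   factorises. *)
transitivity (\int[P2]_w (damping nu a (U w) * damping nu a (V w) *
    cos2 U V (Num.sqrt 2 * t) x w)).
  rewrite expr2 -Rintegral_P2M// -bm_RintegralZl//.
  apply: eq_Rintegral => w _; rewrite -mm /cos2.
  have -> : Num.sqrt 2 * t * U w x = t * Y1 w x + t * Y2 w x.
    by rewrite /U mulrAC mulrA s2 mul1r; ring.
  have -> : Num.sqrt 2 * t * V w x = t * Y1 w x - t * Y2 w x.
    by rewrite /V mulrAC mulrA s2 mul1r; ring.
  by rewrite cosD cosB /Y1 /Y2; ring.
rewrite -damping_rotation mulrDl mul1r -{2}[F _ * F 0]mulrC.
rewrite -!Rintegral_P2M// -bm_RintegralD//.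
apply: eq_Rintegral => w _; rewrite /cos2 /Y1 /Y2 !mul0r cos0; ring.
Qed.

End GaussianRotation.

(** * Moments of the damped field *)

Section DampedMoments.
Context {R : realType} {d dO : measure_display}.
Context {X : measurableType d} {O : measurableType dO}.
Variables (P : probability O R) (Y : O -> X -> R) (K : X -> X -> R).
Hypothesis mY : measurable_fun setT (fun p : O * X => Y p.1 p.2).
Hypothesis gaussY : centered_gaussian_process P Y K.

Let mYx x : measurable_fun setT (Y ^~ x).
Proof. exact: (measurable_section2 x mY). Qed.

Lemma gaussian_cos x (t : R) :
  \int[P]_w cos (t * Y w x) = expR (- 2^-1 * (t ^+ 2 * K x x)).
Proof.
have [E _] := gaussY (fun _ : 'I_1 => x) (fun=> t).
apply: EFin_inj; rewrite -bm_RintegralE; last first.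
  by apply: bm_cos; exact: (measurable_funM (measurable_cst _) (mYx x)).
move: E; rewrite !big_ord1 -expr2 => <-.
by apply: eq_integral => w _; rewrite big_ord1.
Qed.

(** The expectation of [sqr_approx k] is [2 * 4^k * (1 - exp (- r))] with [r = K x x / (2 * 4^k)],
    at most [K x x] by [1 - exp (- r) <= r]; then [k] tends to infinity by monotone convergence. The
    upper bound serves to make [Y^2] integrable. *)
Lemma gaussian_sqr_le x : (\int[P]_w (Y w x ^+ 2)%:E <= (K x x)%:E)%E.
Proof.
have b k : bounded_measurable (fun w => sqr_approx k (Y w x)).
  exact: (bm_comp (mYx x) (bm_sqr_approx k)).
have : (\int[P]_w (sqr_approx k (Y w x))%:E)%E @[k --> \oo] -->
       (\int[P]_w (Y w x ^+ 2)%:E)%E.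
  have e w : (sqr_approx k (Y w x))%:E @[k --> \oo] --> (Y w x ^+ 2)%:E.
    by apply: cvg_EFin; [exact: nearW | exact: sqr_approx_cvg].
  have := @cvg_monotone_convergence _ _ _ P setT measurableT
    (fun k w => (sqr_approx k (Y w x))%:E).
  under [X in _ -> _ -> _ -> _ --> X]eq_integral do rewrite (cvg_lim _ (e _))//.
  apply.
  - by move=> k; apply/measurable_EFinP; case: (b k).
  - by move=> k w _; rewrite lee_fin sqr_approx_ge0.
  - by move=> w _ m n mn; rewrite lee_fin sqr_approx_nd.
move/cvge_to_le; apply; apply: nearW => k.
rewrite bm_RintegralE// lee_fin /sqr_approx.
have bc : bounded_measurable (fun w => cos (2 ^- k * Y w x)).
  by apply: bm_cos; exact: (measurable_funM (measurable_cst _) (mYx x)).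
have -> : \int[P]_w (2 * 4 ^+ k * (1 - cos (Y w x / 2 ^+ k))) =
    2 * 4 ^+ k * (1 - \int[P]_w cos (2 ^- k * Y w x)).
  rewrite bm_RintegralZl; last first.
    by apply: bmB; [exact: bm_cst|move: bc; under eq_fun do rewrite mulrC].
  rewrite bm_RintegralB; [|exact: bm_cst|by move: bc; under eq_fun do rewrite mulrC].
  have -> : \int[P]__ 1 = 1.
    rewrite Rintegral_cst// mul1r.
    by have /(congr1 fine) := probability_setT P.
  by under eq_Rintegral do rewrite mulrC.
rewrite gaussian_cos.
have := expR_ge1Dx (- 2^-1 * ((2 ^- k) ^+ 2 * K x x)).
have p4 : (0 : R) < 4 ^+ k by rewrite exprn_gt0.
have -> : ((2 : R) ^- k) ^+ 2 = (4 ^+ k)^-1.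
  by rewrite exprVn -exprM mulnC exprM (_ : 2 ^+ 2 = 4 :> R)// -natrX.
move=> h; rewrite -ler_pdivlMl ?mulr_gt0//.
have : (2 * 4 ^+ k)^-1 * K x x = 2^-1 * ((4 ^+ k)^-1 * K x x) by rewrite invfM mulrA.
lra.
Qed.

Variables (v : {measure set X -> \bar R}) (Lam : set X).
Hypotheses (mLam : measurable Lam) (finLam : (v Lam < +oo)%E).
Let nu := vrestr mLam finLam.
Variable a : R.
Hypothesis a_ge0 : 0 <= a.

Let D w := damping nu a (Y w).
Let bD : bounded_measurable D.
Proof. exact: (bm_damping nu a_ge0 mY). Qed.
Let D0 w : 0 <= D w.
Proof. exact: damping_ge0. Qed.

Definition damped_char x t := \int[P]_w (damping nu a (Y w) * cos (t * Y w x)).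
Definition damped_sqr x := \int[P]_w (damping nu a (Y w) * Y w x ^+ 2).

Let isqr x : P.-integrable setT (EFin \o (fun w => D w * Y w x ^+ 2)).
Proof.
have mDY : measurable_fun setT (fun w => D w * Y w x ^+ 2).
  by apply: measurable_funM; [case: bD | exact: (measurable_funX 2 (mYx x))].
apply/integrableP; split; first exact/measurable_EFinP.
apply: (@le_lt_trans _ _ (\int[P]_w (Y w x ^+ 2)%:E)%E); last first.
  exact: le_lt_trans (gaussian_sqr_le x) (ltry _).
apply: ge0_le_integral => //.
- by apply: measurableT_comp => //; exact/measurable_EFinP.
- by apply/measurable_EFinP; exact: (measurable_funX 2 (mYx x)).
- move=> w _ /=; rewrite lee_fin ger0_norm; last exact: mulr_ge0 (D0 w) (sqr_ge0 _).
  by rewrite ler_piMl ?sqr_ge0// damping_le1.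
Qed.

Lemma damped_sqr_ge0 x : 0 <= damped_sqr x.
Proof. by apply: Rintegral_ge0 => w _; rewrite mulr_ge0 ?sqr_ge0 ?damping_ge0. Qed.

Let bDcos x t : bounded_measurable (fun w => D w * cos (t * Y w x)).
Proof.
by apply: bmM => //; apply: bm_cos; exact: (measurable_funM (measurable_cst _) (mYx x)).
Qed.

Lemma damped_char_lower x t c : 0 < damped_char x 0 ->
  damped_char x 0 * (1 + c) - t ^+ 2 / 2 * damped_sqr x <= damped_char x t * expR c.
Proof.
move=> Z0; apply: gaussian_lower_bound => //.
- move=> {}t; exact: (damped_char_sqr mY gaussY mLam finLam a_ge0).
- exact: damped_sqr_ge0.
move=> {}t; rewrite lerBlDr -lerBlDl -bm_RintegralB; try exact: bDcos.
have <- : \int[P]_w (t ^+ 2 / 2 * (D w * Y w x ^+ 2)) = t ^+ 2 / 2 * damped_sqr x.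
  by apply: RintegralZl => //; exact: isqr.
apply: le_Rintegral => //.
- by apply: bm_integrable; apply: bmB; exact: bDcos.
- exact: (integrableZl measurableT _ (isqr x)).
move=> w _; rewrite mul0r cos0 -mulrBr mulrCA ler_wpM2l ?damping_ge0//.
by apply: le_trans (one_sub_cos_le _) _; rewrite exprMn; lra.
Qed.

(** Where the form is infinite the damping is 0, so taking [fine] loses nothing. *)
Let DqE w : ((D w)%:E * qform nu a (Y w) = (D w * fine (qform nu a (Y w)))%:E)%E.
Proof.
rewrite /D /damping; have := qform_ge0 nu a_ge0 (Y w).
by case: (qform nu a (Y w)) => [r| |]//= _; rewrite !mul0e mul0r.
Qed.

Let Dq_bound w : 0 <= D w * fine (qform nu a (Y w)) <= 1.
Proof.
rewrite /D /damping; have := qform_ge0 nu a_ge0 (Y w).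
case: (qform nu a (Y w)) => [r| |]//=; last by rewrite mul0r lexx ler01.
rewrite lee_fin => r0; rewrite mulr_ge0 ?expR_ge0//=.
rewrite expRN mulrC ler_pdivrMr ?expR_gt0// mul1r.
by apply: le_trans (expR_ge1Dx r); rewrite lerDr.
Qed.

Let mDq2 : measurable_fun setT (fun p : O * X => (D p.1 * (a * Y p.1 p.2 ^+ 2))%:E).
Proof.
apply/measurable_EFinP; apply: measurable_funM.
  by case: bD => m _; exact: (measurableT_comp m measurable_fst).
exact: (measurable_funM (measurable_cst _) (measurable_funX 2 mY)).
Qed.

Let Dq20 (p : O * X) : (0 <= (D p.1 * (a * Y p.1 p.2 ^+ 2))%:E)%E.
Proof. by rewrite lee_fin mulr_ge0// mulr_ge0// sqr_ge0. Qed.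

Let inner w : (\int[nu]_x (D w * (a * Y w x ^+ 2))%:E =
   (D w * fine (qform nu a (Y w)))%:E)%E.
Proof.
rewrite -DqE /qform -ge0_integralZl_EFin//.
- by move=> x _; rewrite lee_fin mulr_ge0 ?sqr_ge0.
- apply/measurable_EFinP; apply: (measurable_funM (measurable_cst _)).
  exact: (measurable_funX 2 (measurable_section1 w mY)).
Qed.

(** The form is unbounded, but [r exp (- r) <= 1] bounds its damped version. *)
Lemma bm_damped_qform :
  bounded_measurable (fun w => damping nu a (Y w) * fine (qform nu a (Y w))).
Proof.
split; last first.
  by exists 1 => w; have /andP[? ?] := Dq_bound w; rewrite ger0_norm.
have : measurable_fun setT (fubini_F nu (fun p : O * X => (D p.1 * (a * Y p.1 p.2 ^+ 2))%:E)).
  exact: measurable_fun_fubini_tonelli_F.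
rewrite /fubini_F/=; under eq_fun do rewrite inner.
by move/measurable_EFinP.
Qed.

Let outer x : (\int[P]_w (D w * (a * Y w x ^+ 2))%:E)%E = (a * damped_sqr x)%:E.
Proof.
rewrite /damped_sqr -RintegralZl; [|by []|exact: isqr].
rewrite /Rintegral fineK; last first.
  apply: integrable_fin_num => //; exact: (integrableZl measurableT a (isqr x)).
by apply: eq_integral => w _; rewrite mulrCA.
Qed.

(** Tonelli, since [Y^2] is unbounded. The damped mean of the form becomes an integral over [x] of
    second moments, which allows estimates point by point. *)
Lemma damped_sqr_integral :
  nu.-integrable setT (fun x => (a * damped_sqr x)%:E) /\
  \int[nu]_x (a * damped_sqr x) =
  \int[P]_w (damping nu a (Y w) * fine (qform nu a (Y w))).
Proof.
have T : (\int[nu]_x (a * damped_sqr x)%:E)%E =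
    (\int[P]_w (D w * fine (qform nu a (Y w))))%:E.
  rewrite -bm_RintegralE; last exact: bm_damped_qform.
  under eq_integral do rewrite -outer.
  under [RHS]eq_integral do rewrite -inner.
  exact: esym (@fubini_tonelli _ _ _ _ _ P nu _ mDq2 Dq20).
split; last by rewrite {1}/Rintegral T.
apply/integrableP; split.
  have : measurable_fun setT (fubini_G P (fun p : O * X => (D p.1 * (a * Y p.1 p.2 ^+ 2))%:E)).
    exact: measurable_fun_fubini_tonelli_G.
  by rewrite /fubini_G/=; under eq_fun do rewrite outer.
under eq_integral do rewrite gee0_abs ?lee_fin ?mulr_ge0 ?damped_sqr_ge0//.
by rewrite T ltry.
Qed.

Lemma damped_char_integral t :
  bounded_measurable (damped_char ^~ t) /\
  \int[P]_w (damping nu a (Y w) * \int[nu]_x cos (t * Y w x)) =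
  \int[nu]_x damped_char x t.
Proof.
have bc : bounded_measurable (fun p : O * X => cos (t * Y p.1 p.2)).
  by apply: bm_cos; exact: (measurable_funM (measurable_cst _) mY).
have b : bounded_measurable (fun p : O * X => D p.1 * cos (t * Y p.1 p.2)).
  by apply: bmM => //; exact: (bm_comp measurable_fst bD).
split; first exact: (bm_Rintegral1 P nu b).
rewrite -(bm_Fubini P nu b); apply: eq_Rintegral => w _.
by rewrite -bm_RintegralZl//; exact: (bm_pair1 w bc).
Qed.

End DampedMoments.

Lemma EFin_series_cvg {R : realType} (x : nat -> R) (l : R) :
  \sum_(0 <= k < n) x k @[n --> \oo] --> l ->
  (\sum_(0 <= n <oo) (x n)%:E)%E = l%:E.
Proof.
move=> h; apply: cvg_lim => //.
under eq_fun do rewrite sumEFin.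
by apply: cvg_EFin; [exact: nearW | exact: h].
Qed.

(** The terms of [cov_x0] that contain [x0] depend on at most one of the two points, so neutrality
    cancels them. *)
Lemma cov_x0_neutral {R : realType} {d} {X : measurableType d}
    (u : X -> X -> R) (x0 : X) n (x : 'I_n -> X) (c : 'I_n -> R) :
  \sum_(j < n) c j = 0 ->
  \sum_(j < n) \sum_(k < n) c j * c k * cov_x0 u x0 (x j) (x k) =
  \sum_(j < n) \sum_(k < n) c j * c k * u (x j) (x k).
Proof.
move=> c0; pose s := \sum_(k < n) c k * u x0 (x k).
transitivity (\sum_(j < n) (\sum_(k < n) c j * c k * u (x j) (x k) +
   c j * ((u x0 x0 - u (x j) x0) * \sum_(k < n) c k - s))).
  apply: eq_bigr => j _; rewrite /s mulr_sumr -sumrB mulr_sumr -big_split/=.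
  by apply: eq_bigr => k _; rewrite /cov_x0; ring.
rewrite big_split/= c0 [X in _ + X](_ : _ = 0) ?addr0//.
by under eq_bigr do rewrite mulr0 add0r; rewrite -mulr_suml c0 mul0r.
Qed.

(** * Sine-Gordon representation of the partition function *)

Section MeanField.
Context {R : realType} {d dO : measure_display}.
Context {X : measurableType d} {O : measurableType dO}.
Variables (v : {measure set X -> \bar R}) (Lam : set X).
Hypotheses (mLam : measurable Lam) (finLam : (v Lam < +oo)%E).
Variables (u : X -> X -> R) (beta e u0 : R) (s : nat) (z : 'I_s -> R).
Variables (q : 'I_s -> int) (c : R) (x0 : X).
Variables (P : probability O R) (Y : O -> X -> R).
Hypotheses (beta_gt0 : 0 < beta) (e_gt0 : 0 < e) (z_gt0 : forall al, 0 < z al).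
Hypothesis charge_symmetry : forall n : nat,
  \sum_(al < s) (e * (q al)%:~R) ^+ (2 * n).+1
     * expR (e * (q al)%:~R * c) * z al = 0.
Hypothesis mY : measurable_fun setT (fun p : O * X => Y p.1 p.2).
Hypothesis gaussY : centered_gaussian_process P Y (cov_x0 u x0).

Let nu := vrestr mLam finLam.
Let L := fine (v Lam).
Let nuT : fine (nu setT) = L.
Proof. by rewrite /nu vrestr_setT. Qed.
Let ch al : R := e * (q al)%:~R.
Let t al : R := Num.sqrt beta * ch al.
Let z' al := expR (e * (q al)%:~R * c) * z al.
Let w' al := expR (2^-1 * beta * ch al ^+ 2 * u0) * z' al.

Let z'_ge0 al : 0 <= z' al.
Proof. by rewrite mulr_ge0 ?expR_ge0// ltW. Qed.

Lemma odd_charge_sum (h : R -> R) : (forall x, h (- x) = - h x) ->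
  \sum_(al < s) z' al * h (ch al) = 0.
Proof.
move=> hN; apply: odd_moments_odd_fun => // n.
by rewrite -[RHS](charge_symmetry n); apply: eq_bigr => al _; rewrite /z' /ch; ring.
Qed.

(** The factors [exp (e_al c)] multiply to the exponential of [c] times the total charge, that is to
    1; the shift that symmetrises the activities is invisible in neutral sums. *)
Lemma neutral_prod n (a : {ffun 'I_n -> 'I_s}) : neutral q a ->
  \prod_(j < n) z' (a j) = \prod_(j < n) z (a j).
Proof.
move=> /eqP qa; rewrite /z' big_split/=.
rewrite -(big_morph _ (@expRD R) (@expR0 R)) -mulr_suml -mulr_sumr.
by rewrite -(rmorph_sum (intmul 1)) qa mulr0 mul0r expR0 mul1r.
Qed.

Let mYx x : measurable_fun setT (Y ^~ x).
Proof. exact: (measurable_section2 x mY). Qed.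
Let mtY (r : R) : measurable_fun setT (fun p : O * X => r * Y p.1 p.2).
Proof. exact: (measurable_funM (measurable_cst _) mY). Qed.

Let g al (p : O * X) : R[i] := (w' al)%:C%C * cexpi (t al * Y p.1 p.2).
Let bg al : cbounded_measurable (g al).
Proof.
by apply: cbmM; [split; exact: bm_cst | exact: cbm_cexpi].
Qed.

Let T al w := cintegral nu (fun x => g al (w, x)).

(** The coefficients [t (a j)] sum to 0, so the characteristic function there sees [u] itself and
    equals [exp (- beta U)], the two factors [sqrt beta] producing [beta]. *)
Lemma gibbs_weight n (a : {ffun 'I_n -> 'I_s}) (xs : seq X) : neutral q a ->
  expR (- beta * energy (fun al => e * (q al)%:~R) u x0 a xs) *
     \prod_(j < n) (expR (2^-1 * beta * (e * (q (a j))%:~R) ^+ 2 * u0) * z (a j)) =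
  \int[P]_w Re (\prod_(j < n) g (a j) (w, nth x0 xs j)).
Proof.
move=> na; pose x (j : 'I_n) := nth x0 xs j.
have st : \sum_(j < n) t (a j) = 0.
  rewrite -mulr_sumr -mulr_sumr -(rmorph_sum (intmul 1)).
  by move/eqP : na => ->; rewrite !mulr0.
have mS : measurable_fun setT (fun w => \sum_(j < n) t (a j) * Y w (x j)).
  by apply: measurable_bigsum => j; exact: (measurable_funM (measurable_cst _) (mYx _)).
transitivity ((\prod_(j < n) w' (a j)) *
    \int[P]_w cos (\sum_(j < n) t (a j) * Y w (x j))); last first.
  rewrite -bm_RintegralZl; last exact: bm_cos.
  apply: eq_Rintegral => w _; rewrite /g [in RHS]big_split/=.
  rewrite -(big_morph _ cexpiD cexpi0) -(rmorph_prod (real_complex R))/=.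
  by rewrite mul0r subr0.
have [E _] := gaussY x (fun j => t (a j)).
have -> : \int[P]_w cos (\sum_(j < n) t (a j) * Y w (x j)) =
    expR (- beta * energy (fun al => e * (q al)%:~R) u x0 a xs).
  apply: EFin_inj; rewrite -bm_RintegralE; last exact: bm_cos.
  rewrite E cov_x0_neutral//; congr (expR _)%:E.
  rewrite /energy mulrA !mulr_sumr; apply: eq_bigr => j _.
  rewrite !mulr_sumr; apply: eq_bigr => k _; rewrite /t /ch.
  have sb : Num.sqrt beta * Num.sqrt beta = beta by rewrite -expr2 sqr_sqrtr// ltW.
  rewrite -[in - beta]sb; rewrite /x; ring.
rewrite mulrC; congr (_ * _); rewrite big_split/= -(neutral_prod na) -big_split.
by apply: eq_bigr => j _.
Qed.

Lemma gibbs_weight_integral n (a : {ffun 'I_n -> 'I_s}) : neutral q a ->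
  iter_int v Lam n (fun xs =>
    (expR (- beta * energy (fun al => e * (q al)%:~R) u x0 a xs) *
     \prod_(j < n) (expR (2^-1 * beta * (e * (q (a j))%:~R) ^+ 2 * u0)
                      * z (a j)))%:E) =
  (\int[P]_w Re (\prod_(j < n) T (a j) w))%:E.
Proof.
move=> na.
(* Extends the factors from ['I_n] to all naturals, as [iter_int_cintegral] requires; the default 1
   is never read. *)
pose gg j p := if insub j is Some i then g (a i) p else 1 : R[i].
have ggE (i : 'I_n) p : gg i p = g (a i) p by rewrite /gg valK.
have bgg j : cbounded_measurable (gg j).
  by rewrite /gg; case: insub => [i|]; [exact: bg | split; exact: bm_cst].
have b1 : cbounded_measurable (fun _ : O => 1 : R[i]) by split; exact: bm_cst.
have := iter_int_cintegral mLam finLam P x0 n bgg b1.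
transitivity (iter_int v Lam n (fun xs =>
    (\int[P]_w Re (1 * \prod_(j < n) gg j (w, nth x0 xs j)))%:E)).
  congr iter_int; apply/funext => xs; rewrite gibbs_weight//; congr EFin.
  apply: eq_Rintegral => w _; rewrite mul1r; congr Re.
  by apply: eq_bigr => j _; rewrite ggE.
rewrite H; congr EFin; apply: eq_Rintegral => w _; rewrite mul1r; congr Re.
apply: eq_bigr => j _; rewrite /T -/nu; congr cintegral; apply/funext => x.
by rewrite ggE.
Qed.

Let cs al w := \int[nu]_x cos (t al * Y w x).
Let sn al w := \int[nu]_x sin (t al * Y w x).

Let bcs al : bounded_measurable (cs al).
Proof. exact: (bm_Rintegral2 P nu (bm_cos (mtY (t al)))). Qed.
Let bsn al : bounded_measurable (sn al).
Proof. exact: (bm_Rintegral2 P nu (bm_sin (mtY (t al)))). Qed.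

Let B w (th : R) := \sum_(al < s) w' al *
  (cs al w * cos ((q al)%:~R * th) - sn al w * sin ((q al)%:~R * th)).

Let bcos (k : int) : bounded_measurable (fun th : measurableTypeR R => cos (k%:~R * th)).
Proof. exact: bm_cos. Qed.
Let bsin (k : int) : bounded_measurable (fun th : measurableTypeR R => sin (k%:~R * th)).
Proof. exact: bm_sin. Qed.

Let bB : bounded_measurable (fun p : O * measurableTypeR R => B p.1 p.2).
Proof.
apply: bm_sum => al; apply: bmZ; apply: bmB; apply: bmM.
- exact: (bm_comp measurable_fst (bcs al)).
- exact: (bm_comp measurable_snd (bcos (q al))).
- exact: (bm_comp measurable_fst (bsn al)).
- exact: (bm_comp measurable_snd (bsin (q al))).
Qed.

Let mtYw al w : measurable_fun setT (fun x => t al * Y w x).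
Proof. exact: (measurable_funM (measurable_cst _) (measurable_section1 w mY)). Qed.

(* Charge symmetry kills the imaginary part. *)
Lemma activity_sum w th :
  \sum_(al < s) T al w * cexpi ((q al)%:~R * th) = (B w th)%:C%C.
Proof.
have TE al : T al w = (w' al)%:C%C * (cs al w +i* sn al w)%C.
  by rewrite /T /g cintegralZ//; exact: (cbm_cexpi (mtYw al w)).
pose S := \sum_(al < s) T al w * cexpi ((q al)%:~R * th).
suff [E1 E2] : Re S = B w th /\ Im S = 0 by move: E1 E2; rewrite -/S; case: S => ? ? /= -> ->.
split.
  rewrite /S raddf_sum; apply: eq_bigr => al _.
  by rewrite TE /cexpi /=; ring.
rewrite /S raddf_sum.
transitivity (\int[nu]_x (\sum_(al < s) w' al * sin (t al * Y w x + (q al)%:~R * th))).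
  rewrite bm_Rintegral_sum; last first.
    move=> al; apply: bmZ; apply: bm_sin.
    exact: (measurable_funD (mtYw al w) (measurable_cst _)).
  apply: eq_bigr => al _.
  have b1 := bm_cos (mtYw al w); have b2 := bm_sin (mtYw al w).
  under [RHS]eq_Rintegral do rewrite sinD.
  rewrite bm_RintegralZl; last by apply: bmD; apply: bmM => //; exact: bm_cst.
  rewrite bm_RintegralD; [|by apply: bmM => //; exact: bm_cst..].
  by rewrite !bm_RintegralZr// TE /cexpi/= /cs /sn; ring.
under eq_Rintegral => x _.
  rewrite (_ : \sum_(al < s) _ = 0); first by over.
  have e0 : e != 0 by rewrite gt_eqF.
  (* Apart from [z'], the species enters through its charge [r] alone; dividing [th] by [e] writes
     [q_al th] as [r * (th / e)], and the self-energy factor is even in [r]. *)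
  pose h r := expR (2^-1 * beta * r ^+ 2 * u0) *
    sin (r * (Num.sqrt beta * Y w x + th / e)).
  rewrite -[RHS](@odd_charge_sum h); last first.
    by move=> r; rewrite /h sqrrN mulNr sinN mulrN.
  apply: eq_bigr => al _; rewrite /h /w' -/(z' al) mulrAC mulrC; congr (_ * (_ * sin _)).
  by rewrite /t /ch; field.
by rewrite Rintegral_cst// mul0r.
Qed.

Let tpi_gt0 : 0 < 2 * pi :> R.
Proof. by rewrite mulr_gt0 ?pi_gt0. Qed.

Lemma neutral_gas_sum n w :
  \sum_(a : {ffun 'I_n -> 'I_s} | neutral q a) Re (\prod_(j < n) T (a j) w) =
  (2 * pi)^-1 * \int[circle]_th B w th ^+ n.
Proof.
apply: (mulfI (lt0r_neq0 tpi_gt0)); rewrite mulVKf ?lt0r_neq0//.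
rewrite -(neutral_projection n q (T ^~ w)).
apply: eq_Rintegral => th _.
by rewrite activity_sum -(rmorphXn (real_complex R)).
Qed.

(** The [n]-body term is the mean of [B ^ n] over angle and field. The series is summed under the
    angle integral at fixed [w], then under the field integral; the uniform bound [M] of [B]
    dominates both. *)
Lemma Xi_sine_gordon : Xi v Lam q e beta u0 z u x0 =
  ((2 * pi)^-1 * \int[P]_w \int[circle]_th expR (B w th))%:E.
Proof.
have bBn n : bounded_measurable (fun w => \int[circle]_th B w th ^+ n).
  exact: (bm_Rintegral2 P circle (bmX n bB)).
have bT al : cbounded_measurable (T al).
  have [b1 b2] := bg al.
  by split; [exact: (bm_Rintegral2 P nu b1) | exact: (bm_Rintegral2 P nu b2)].
pose x n := n`!%:R^-1 * ((2 * pi)^-1 * \int[P]_w \int[circle]_th B w th ^+ n).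
transitivity (\sum_(0 <= n <oo) (x n)%:E)%E.
  apply: eq_eseriesr => n _.
  rewrite (eq_bigr _ (fun a na => gibbs_weight_integral na)) sumEFin -EFinM.
  congr (_ * _)%:E; rewrite -bm_Rintegral_sum; last first.
    by move=> a; apply: proj1; apply: cbm_prod => j; exact: bT.
  rewrite -bm_RintegralZl//; apply: eq_Rintegral => w _; exact: neutral_gas_sum.
apply: EFin_series_cvg.
have [M M0 BM] := bm_bound bB.
have -> : (fun n : nat => \sum_(0 <= k < n) x k) = (fun n => (2 * pi)^-1 *
    \int[P]_w \sum_(0 <= k < n) k`!%:R^-1 * \int[circle]_th (1 * B w th ^+ k)).
  apply/funext => n; rewrite bm_Rintegral_sum; last first.
    move=> k; apply: bmZ; have := bBn k.
    by congr bounded_measurable; apply/funext => w; apply: eq_Rintegral => th _; rewrite mul1r.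
  rewrite mulr_sumr; apply: eq_bigr => k _; rewrite /x mulrCA; congr (_ * _).
  rewrite -bm_RintegralZl//; apply: eq_Rintegral => w _; congr (_ * _).
  by apply: eq_Rintegral => th _; rewrite mul1r.
apply: cvgM; first exact: cvg_cst.
have bBw w : bounded_measurable (fun th : measurableTypeR R => B w th).
  exact: (bm_pair1 w bB).
apply: (@bm_Rintegral_cvg _ _ _ P _ _ (expR M * (2 * pi))).
- move=> n; apply: proj1; apply: bm_sum => k; apply: bmZ; have := bBn k.
  by congr bounded_measurable; apply/funext => w; apply: eq_Rintegral => th _; rewrite mul1r.
- move=> n w.
  have -> : \sum_(0 <= k < n) k`!%:R^-1 * \int[circle]_th (1 * B w th ^+ k) =
      \int[circle]_th \sum_(0 <= k < n) k`!%:R^-1 * B w th ^+ k.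
    rewrite bm_Rintegral_sum; last by move=> k; apply: bmZ; exact: bmX.
    apply: eq_bigr => k _; rewrite -bm_RintegralZl; last first.
      by apply: bmM; [exact: bm_cst | exact: bmX].
    by apply: eq_Rintegral => th _; rewrite mul1r.
  rewrite -circle_setT; apply: bm_Rintegral_bound.
    by apply: bm_sum => k; apply: bmZ; exact: bmX.
  by move=> th; apply: le_series_exp_coeff; exact: (BM (w, th)).
- move=> w; have := exp_moments_cvg (mu := circle) (bm_cst 1) (bBw w).
  by under [X in _ --> X -> _]eq_Rintegral do rewrite mul1r.
Qed.

(** * The ideal-gas weight and its Fourier coefficients *)

Let W := eta_weight L q z'.
Let ell (th : R) := L * \sum_(al < s) z' al * cos ((q al)%:~R * th).

Let bell : bounded_measurable (ell : measurableTypeR R -> R).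
Proof. by apply: bmZ; apply: bm_sum => al; exact: bmZ. Qed.

Let bW : bounded_measurable (W : measurableTypeR R -> R).
Proof. exact: bm_exp bell. Qed.

(** The same computation without the field: [ell] takes the place of [B], and charge symmetry again
    removes the imaginary part. *)
Lemma Xi0_circle : Xi0 L q z = ((2 * pi)^-1 * \int[circle]_th W th)%:E.
Proof.
pose x n := n`!%:R^-1 * ((2 * pi)^-1 * \int[circle]_th ell th ^+ n).
transitivity (\sum_(0 <= n <oo) (x n)%:E)%E.
  apply: eq_eseriesr => n _; congr (_ * _)%:E.
  have := neutral_projection n q (fun al => (z' al * L)%:C%C).
  have E th : \sum_(al < s) (z' al * L)%:C%C * cexpi ((q al)%:~R * th) = (ell th)%:C%C.
    pose S := \sum_(al < s) (z' al * L)%:C%C * cexpi ((q al)%:~R * th).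
    suff [E1 E2] : Re S = ell th /\ Im S = 0.
      by move: E1 E2; rewrite -/S; case: S => ? ? /= -> ->.
    split.
      rewrite /S raddf_sum /ell mulr_sumr; apply: eq_bigr => al _.
      by rewrite /cexpi /=; ring.
    rewrite /S raddf_sum.
    have h0 : \sum_(al < s) z' al * sin (ch al * (th / e)) = 0.
      by apply: (@odd_charge_sum (fun r => sin (r * (th / e)))) => r; rewrite mulNr sinN.
    transitivity (L * \sum_(al < s) z' al * sin (ch al * (th / e))).
      rewrite mulr_sumr; apply: eq_bigr => al _; rewrite /cexpi /ch /=.
      rewrite (_ : e * (q al)%:~R * (th / e) = (q al)%:~R * th); first by ring.
      by field; rewrite gt_eqF.
    by rewrite h0 mulr0.
  under eq_Rintegral do rewrite E -(rmorphXn (real_complex R))/=.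
  move=> ->; rewrite mulKf ?lt0r_neq0//.
  apply: eq_bigr => a na; rewrite -(rmorph_prod (real_complex R))/=.
  by rewrite big_split [RHS]big_split/= neutral_prod.
apply: EFin_series_cvg.
have -> : (fun n : nat => \sum_(0 <= k < n) x k) = (fun n => (2 * pi)^-1 *
    \sum_(0 <= k < n) k`!%:R^-1 * \int[circle]_th (1 * ell th ^+ k)).
  apply/funext => n; rewrite mulr_sumr; apply: eq_bigr => k _.
  rewrite /x mulrCA; congr (_ * (_ * _)).
  by apply: eq_Rintegral => th _; rewrite mul1r.
apply: cvgM; first exact: cvg_cst.
have := exp_moments_cvg (mu := circle) (bm_cst 1) bell.
by under [X in _ --> X -> _]eq_Rintegral do rewrite mul1r.
Qed.

Let DW := \int[circle]_th W th.
Let et al := eta_hat L q z' (q al).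

Let L_ge0 : 0 <= L.
Proof. by rewrite /L fine_ge0. Qed.

Lemma eta_weight_integral_gt0 : 0 < DW.
Proof.
have [M M0 lM] := bm_bound bell.
apply: (@lt_le_trans _ _ (\int[circle]__ expR (- M))).
  by rewrite Rintegral_cst// circle_setT mulr_gt0 ?expR_gt0.
apply: bm_le_Rintegral => //; first exact: bm_cst.
by move=> th; rewrite ler_expR; have := lM th; rewrite ler_norml => /andP[].
Qed.

Let WE th : W th = expR (\sum_(al < s) (L * z' al) * cos ((q al)%:~R * th)).
Proof. by rewrite /W /eta_weight mulr_sumr; under eq_bigr do rewrite mulrA. Qed.

Let Lz' al : 0 <= L * z' al.
Proof. exact: mulr_ge0. Qed.

Lemma eta_hatE al : \int[circle]_th (W th * cos ((q al)%:~R * th)) = et al * DW.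
Proof.
rewrite /et /eta_hat !circleE ?divfK//; first by rewrite gt_eqF// eta_weight_integral_gt0.
exact: bmM.
Qed.

Lemma eta_weight_sin al : \int[circle]_th (W th * sin ((q al)%:~R * th)) = 0.
Proof.
have [_ <-] := fourier_exp_cos (index_enum 'I_s) q (q al) Lz'.
by apply: eq_Rintegral => th _; rewrite WE mulrC.
Qed.

(** Lets the pointwise inequalities be weighted by [z' al * et al] and summed over species; it also
    makes [a] nonnegative. *)
Lemma eta_hat_ge0 al : 0 <= et al.
Proof.
rewrite -(pmulr_lge0 _ eta_weight_integral_gt0) -eta_hatE.
have [h _] := fourier_exp_cos (index_enum 'I_s) q (q al) Lz'.
by move: h; congr (_ <= _); apply: eq_Rintegral => th _; rewrite WE mulrC.
Qed.

(** * The tilted inequality *)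

Let a := 2^-1 * xi0_inv2 L beta e q z'.

Let t2 al : t al ^+ 2 = beta * ch al ^+ 2.
Proof. by rewrite /t exprMn sqr_sqrtr// ltW. Qed.

Let aE : a = \sum_(al < s) z' al * et al * (t al ^+ 2 / 2).
Proof.
rewrite /a /xi0_inv2 !mulr_sumr; apply: eq_bigr => al _.
by rewrite t2 -/(et al) /ch; field.
Qed.

Let ze_ge0 al : 0 <= z' al * et al.
Proof. by rewrite mulr_ge0// eta_hat_ge0. Qed.

Let a_ge0 : 0 <= a.
Proof. by rewrite aE sumr_ge0// => al _; rewrite mulr_ge0// divr_ge0// sqr_ge0. Qed.

Let D w := damping nu a (Y w).
Let fq w := fine (qform nu a (Y w)).
Let Z := \int[P]_w D w.
(** The constant part of [- V_2]: [exp (- V_2)] equals [k0 * D]. *)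
Let k0 := expR (a * u0 * L).

Let bD : bounded_measurable D.
Proof. exact: (bm_damping nu a_ge0 mY). Qed.
Let bDfq : bounded_measurable (fun w => D w * fq w).
Proof. exact: (bm_damped_qform mY mLam finLam a_ge0). Qed.

(* [exp y >= 1 + y] with [y = B - ell + V_2]. *)
Lemma exp_mean_field_le w th :
  k0 * (W th * (D w * (1 - a * u0 * L) + D w * fq w) +
        (D w * (W th * B w th) - D w * (W th * ell th))) <= expR (B w th).
Proof.
have WE' : W th = expR (ell th) by [].
rewrite /D /fq /damping; have := qform_ge0 nu a_ge0 (Y w).
(* If the form is infinite, the damping makes the left side 0. *)
case: (qform nu a (Y w)) => [r| |]//= _; last first.
  by rewrite !mul0r add0r mulr0 subr0 add0r mulr0 expR_ge0.
apply: (@le_trans _ _ (k0 * W th * expR (- r) *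
    (1 + (B w th - ell th - a * u0 * L + r)))); first by rewrite le_eqVlt; apply/orP; left; apply/eqP; ring.
apply: (@le_trans _ _ (k0 * W th * expR (- r) *
    expR (B w th - ell th - a * u0 * L + r))).
  by rewrite ler_wpM2l ?expR_ge1Dx// !mulr_ge0 ?expR_ge0.
by rewrite /k0 WE' -!expRD le_eqVlt; apply/orP; left; apply/eqP; congr expR; ring.
Qed.

(** Integration over the weighted angle replaces each cosine by [et al * DW] and drops the sines,
    leaving an expression in the field alone. *)
Lemma circle_exp_mean_field_le w :
  k0 * (DW * (D w * (1 - a * u0 * L) + D w * fq w +
     \sum_(al < s) z' al * et al *
        (expR (t al ^+ 2 / 2 * u0) * (D w * cs al w) - L * D w))) <=
  \int[circle]_th expR (B w th).
Proof.
have bBw : bounded_measurable (fun th : measurableTypeR R => B w th).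
  exact: (bm_pair1 w bB).
have bWB := bmM bW bBw; have bWl := bmM bW bell.
set A := D w * (1 - a * u0 * L) + D w * fq w.
have E1 : \int[circle]_th (W th * B w th) =
    \sum_(al < s) w' al * (cs al w * (et al * DW)).
  transitivity (\int[circle]_th \sum_(al < s) w' al *
    (cs al w * (W th * cos ((q al)%:~R * th)) - sn al w * (W th * sin ((q al)%:~R * th)))).
    apply: eq_Rintegral => th _; rewrite /B mulr_sumr; apply: eq_bigr => al _; ring.
  have bWc al : bounded_measurable (fun th : measurableTypeR R => W th * cos ((q al)%:~R * th)).
    exact: bmM.
  have bWs al : bounded_measurable (fun th : measurableTypeR R => W th * sin ((q al)%:~R * th)).
    exact: bmM.
  rewrite bm_Rintegral_sum; last by move=> al; apply: bmZ; apply: bmB; exact: bmZ.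
  apply: eq_bigr => al _; rewrite bm_RintegralZl; last by apply: bmB; exact: bmZ.
  rewrite bm_RintegralB; [|exact: bmZ..].
  by rewrite !bm_RintegralZl// eta_hatE eta_weight_sin mulr0 subr0.
have E2 : \int[circle]_th (W th * ell th) = \sum_(al < s) L * (z' al * (et al * DW)).
  transitivity (\int[circle]_th \sum_(al < s) L * z' al * (W th * cos ((q al)%:~R * th))).
    by apply: eq_Rintegral => th _; rewrite /ell mulrCA mulr_sumr mulr_sumr; apply: eq_bigr => al _; ring.
  rewrite bm_Rintegral_sum; last by move=> al; apply: bmZ; exact: bmM.
  apply: eq_bigr => al _; rewrite bm_RintegralZl; last exact: bmM.
  by rewrite eta_hatE -mulrA.
have -> : k0 * (DW * (A + \sum_(al < s) z' al * et al *
      (expR (t al ^+ 2 / 2 * u0) * (D w * cs al w) - L * D w))) =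
    \int[circle]_th (k0 * (W th * A + (D w * (W th * B w th) - D w * (W th * ell th)))).
  rewrite bm_RintegralZl; last first.
    by apply: bmD; [apply: bmM => //; exact: bm_cst | apply: bmB; exact: bmZ].
  congr (_ * _); rewrite bm_RintegralD; last 2 first.
  - by apply: bmM => //; exact: bm_cst.
  - by apply: bmB; exact: bmZ.
  rewrite bm_RintegralZr// bm_RintegralB; [|exact: bmZ..].
  rewrite !bm_RintegralZl// E1 E2 mulrDr; congr (_ + _).
  rewrite !mulr_sumr -sumrB; apply: eq_bigr => al _.
  have -> : w' al = expR (t al ^+ 2 / 2 * u0) * z' al.
    by rewrite /w' t2; congr (expR _ * _); field.
  ring.
apply: bm_le_Rintegral; last by move=> th; exact: exp_mean_field_le.
  apply: bmZ; apply: bmD; first by apply: bmM => //; exact: bm_cst.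
  by apply: bmB; exact: bmZ.
exact: bm_exp.
Qed.

(** This is the nonnegative mean of [y], multiplied by [Z] so that the tilt stays unnormalised. It
    follows by integrating over [x] the bound [damped_char_lower] with [c = t^2 u0 / 2]. *)
Lemma mean_field_gap_ge0 : 0 < Z ->
  a * u0 * L * Z <= \int[P]_w (D w * fq w) +
  \sum_(al < s) z' al * et al *
    (expR (t al ^+ 2 / 2 * u0) * (\int[P]_w (D w * cs al w)) - L * Z).
Proof.
move=> Z0.
pose F x r := damped_char P Y mLam finLam a x r.
have FZ x : F x 0 = Z by apply: eq_Rintegral => w _; rewrite mul0r cos0 mulr1.
have [iM EM] := damped_sqr_integral mY gaussY mLam finLam a_ge0.
(* A lower bound for [a * damped_sqr x], species by species: [aE] splits [a] into multiples of
   [t al ^ 2 / 2], which is where the mean-field value enters. *)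
pose kap x := \sum_(al < s) z' al * et al *
  (Z * (1 + t al ^+ 2 / 2 * u0) - expR (t al ^+ 2 / 2 * u0) * F x (t al)).
have bF al : bounded_measurable (F ^~ (t al)).
  exact: (damped_char_integral P mY mLam finLam a_ge0 (t al)).1.
have bk al : bounded_measurable (fun x => Z * (1 + t al ^+ 2 / 2 * u0) -
    expR (t al ^+ 2 / 2 * u0) * F x (t al)).
  by apply: bmB; [exact: bm_cst | exact: bmZ].
have bkap : bounded_measurable kap by apply: bm_sum => al; exact: bmZ.
have h : \int[nu]_x kap x <= \int[P]_w (D w * fq w).
  rewrite -[leRHS]EM; apply: le_Rintegral => //; first exact: bm_integrable.
  move=> x _; rewrite {1}aE mulr_suml; apply: ler_sum => al _.
  rewrite -[leRHS]mulrA; apply: ler_wpM2l => //.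
  rewrite lerBlDr -lerBlDl [_ * F _ _]mulrC -(FZ x).
  have Zx : 0 < F x 0 by rewrite FZ.
  by rewrite /F in Zx *; exact: damped_char_lower.
apply: le_trans (lerD h (lexx _)).
rewrite bm_Rintegral_sum; last by move=> al; exact: bmZ.
rewrite -big_split/= aE !mulr_suml; apply: ler_sum => al _.
rewrite bm_RintegralZl// bm_RintegralB; [|exact: bm_cst|exact: bmZ].
rewrite Rintegral_cst// nuT bm_RintegralZl//.
rewrite -(damped_char_integral P mY mLam finLam a_ge0 (t al)).2.
by rewrite le_eqVlt; apply/orP; left; apply/eqP; rewrite /cs /D /nu; ring.
Qed.

Lemma mean_field_le :
  DW * (k0 * Z) <= \int[P]_w \int[circle]_th expR (B w th).
Proof.
have bE : bounded_measurable (fun w => \int[circle]_th expR (B w th)).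
  exact: (bm_Rintegral2 P circle (bm_exp bB)).
have Zge0 : 0 <= Z by apply: Rintegral_ge0 => w _; exact: damping_ge0.
(* If [Z = 0] there is no tilted measure to average over, but then the left side is 0. *)
have [Z0|Z0] := leP Z 0.
  have -> : Z = 0 by apply/le_anti/andP.
  rewrite !mulr0; apply: Rintegral_ge0 => w _; apply: Rintegral_ge0 => th _.
  exact: expR_ge0.
have bDc al : bounded_measurable (fun w => D w * cs al w) by exact: bmM.
have bS al : bounded_measurable (fun w =>
    expR (t al ^+ 2 / 2 * u0) * (D w * cs al w) - L * D w).
  by apply: bmB; exact: bmZ.
have bA : bounded_measurable (fun w => D w * (1 - a * u0 * L) + D w * fq w).
  by apply: bmD => //; apply: bmM => //; exact: bm_cst.
have bSS : bounded_measurable (fun w => \sum_(al < s) z' al * et al *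
    (expR (t al ^+ 2 / 2 * u0) * (D w * cs al w) - L * D w)).
  by apply: bm_sum => al; exact: bmZ.
apply: le_trans (bm_le_Rintegral _ _ _ circle_exp_mean_field_le) => //; last first.
  by apply: bmZ; apply: bmZ; exact: bmD.
rewrite bm_RintegralZl; last by apply: bmZ; exact: bmD.
rewrite bm_RintegralZl; last exact: bmD.
rewrite mulrCA ler_pM2l ?expR_gt0// ler_pM2l ?eta_weight_integral_gt0//.
rewrite bm_RintegralD// bm_RintegralD//; last by apply: bmM => //; exact: bm_cst.
rewrite bm_RintegralZr// -/Z bm_Rintegral_sum; last by move=> al; exact: bmZ.
have := mean_field_gap_ge0 Z0.
have -> : \sum_(al < s) z' al * et al *
    (expR (t al ^+ 2 / 2 * u0) * (\int[P]_w (D w * cs al w)) - L * Z) =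
  \sum_(al < s) \int[P]_w (z' al * et al *
    (expR (t al ^+ 2 / 2 * u0) * (D w * cs al w) - L * D w)).
  apply: eq_bigr => al _; rewrite bm_RintegralZl// bm_RintegralB; [|exact: bmZ..].
  by rewrite !bm_RintegralZl.
lra.
Qed.

Lemma expectation_expV2 :
  (\int[P]_w expeR (- V2 v Lam (xi0_inv2 L beta e q z') u0 (Y w)) = (k0 * Z)%:E)%E.
Proof.
rewrite /Z -bm_RintegralZl// -bm_RintegralE; last exact: bmZ.
apply: eq_integral => w _.
have mYw : measurable_fun setT (fun x => (Y w x ^+ 2)%:E).
  by apply/measurable_EFinP; exact: (measurable_funX 2 (measurable_section1 w mY)).
have -> : V2 v Lam (xi0_inv2 L beta e q z') u0 (Y w) =
    (qform nu a (Y w) - (a * u0 * L)%:E)%E.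
  rewrite /V2 -/L -/a; congr (_ - _)%E.
  rewrite (ge0_vrestrE mLam finLam mYw); last by move=> x; rewrite lee_fin sqr_ge0.
  rewrite -ge0_integralZl_EFin//.
  by move=> x _; rewrite lee_fin sqr_ge0.
rewrite /D /damping; have := qform_ge0 nu a_ge0 (Y w).
case: (qform nu a (Y w)) => [r| |]//= _; last by rewrite mulr0.
by rewrite -expRD opprB addrC.
Qed.

Lemma mean_field_lower_bound :
  (Xi0 L q z * \int[P]_w expeR (- V2 v Lam (xi0_inv2 L beta e q z') u0 (Y w))
   <= Xi v Lam q e beta u0 z u x0)%E.
Proof.
rewrite Xi_sine_gordon Xi0_circle expectation_expV2 -EFinM lee_fin -mulrA.
by apply: ler_wpM2l; [rewrite invr_ge0 ltW | exact: mean_field_le].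
Qed.

End MeanField.

Theorem theorem1 (R : realType) (d : measure_display) (X : measurableType d)
  (v : {measure set X -> \bar R}) (Lam : set X)
  (u : X -> X -> R) (beta e u0 : R) (s : nat) (z : 'I_s -> R) (q : 'I_s -> int)
  (c : R) (x0 : X)
  (dO : measure_display) (O : measurableType dO) (P : probability O R)
  (Y : O -> X -> R) :
  measurable Lam -> (v Lam < +oo)%E ->
  measurable_fun setT (fun p : X * X => u p.1 p.2) ->
  (forall x y, u x y = u y x) ->
  cond_pos_def u ->
  0 < beta -> 0 < e ->
  (forall al, 0 < z al) ->
  (forall n : nat, \sum_(al < s) (e * (q al)%:~R) ^+ (2 * n).+1
                      * expR (e * (q al)%:~R * c) * z al = 0) ->
  measurable_fun setT (fun p : O * X => Y p.1 p.2) ->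
  centered_gaussian_process P Y (cov_x0 u x0) ->
  let L := fine (v Lam) in
  let z' := fun al => expR (e * (q al)%:~R * c) * z al in
  (Xi v Lam q e beta u0 z u x0 >=
   Xi0 L q z *
   \int[P]_w expeR (- V2 v Lam (xi0_inv2 L beta e q z') u0 (Y w)))%E.
Proof.
move=> mLam finLam _ _ _ beta0 e0 z0 sym mY gY.
exact: (mean_field_lower_bound mLam finLam u0 beta0 e0 z0 sym mY gY).
Qed.
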